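(* Let $n\ge 2$ and let $f\in C^{0,1}(\mathbb{S}^n)$ be a positive function. Extend $f$ to $\mathbb{R}^{n+1}\setminus\{0\}$ so that it is homogeneous of degree $-1$. Let $u$ be a solution of $$\Delta_{\mathbb{S}^n}u+nu=f\quad\text{on }\mathbb{S}^n .$$ Then $u$ is convex, provided $$\partial_\xi f(x+t\xi)-\partial_\xi f(x-t\xi)\le 0\qquad\text{for all }t>0,\ \xi\in\mathbb{S}^n,\ x\in\mathbb{R}^{n+1}\text{ with }\langle\xi,x\rangle=0 .$$
   Context: $\Delta_{\mathbb{S}^n}$ is the Laplace–Beltrami operator on the unit sphere $\mathbb{S}^n\subset\mathbb{R}^{n+1}$. $\partial_\xi f(y)=\langle Df(y),\xi\rangle$ is the derivative of the extended function $f$ at $y$ in direction $\xi$; since $f$ is locally Lipschitz away from $0$, these derivatives exist almost everywhere, and the inequality is understood at points where they exist. A solution $u$ is called convex if $\nabla^2u+uI\ge0$ on $\mathbb{S}^n$, where $\nabla$ is the covariant derivative with respect to a local orthonormal frame on $\mathbb{S}^n$; equivalently, the degree-one homogeneous extension of $u$ to $\mathbb{R}^{n+1}$ is convex. *)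

(* Defs.v *)
From mathcomp Require Import all_boot all_order all_algebra.
From mathcomp Require Import all_classical all_reals all_analysis.

Set Implicit Arguments.
Unset Strict Implicit.
Unset Printing Implicit Defensive.

Import Order.TTheory GRing.Theory Num.Theory.
Import numFieldNormedType.Exports.

Local Open Scope classical_set_scope.
Local Open Scope ring_scope.

(* The norm `|x| carried by 'rV[R]_m is the sup norm, so the Euclidean
   structure of R^m is given separately; the topology is the same.
   A function on the sphere S^n is represented by a function on R^(n+1), of
   which only the values on the sphere matter: everything below depends on it
   only through its homogeneous extensions. *)

Definition edot (R : realType) (m : nat) (x y : 'rV[R]_m) : R :=
  \sum_(i < m) x 0 i * y 0 i.

Definition enorm (R : realType) (m : nat) (x : 'rV[R]_m) : R :=
  Num.sqrt (edot x x).

Definition unit_sphere (R : realType) (n : nat) : set 'rV[R]_n.+1 :=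
  [set x | enorm x = 1].

Definition radial_proj (R : realType) (m : nat) (x : 'rV[R]_m) : 'rV[R]_m :=
  (enorm x)^-1 *: x.

(* Meaningful on R^m \ {0} only; the value at 0 is a junk value. *)
Definition homog_ext (R : realType) (m : nat) (k : int) (u : 'rV[R]_m -> R)
    (x : 'rV[R]_m) : R :=
  enorm x ^ k * u (radial_proj x).

Definition tangent_proj (R : realType) (m : nat) (x v : 'rV[R]_m) : 'rV[R]_m :=
  v - edot x v *: x.

Definition sphere_C2 (R : realType) (n : nat) (u : 'rV[R]_n.+1 -> R) : Prop :=
  let U := homog_ext 0 u in
  forall x : 'rV[R]_n.+1, x != 0 ->
    differentiable U x /\
    (forall v, differentiable ('D_v U) x) /\
    (forall v w, {for x, continuous ('D_w ('D_v U))}).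

(* Riemannian gradient: tangential part of the Euclidean gradient of an
   extension of u. *)
Definition sphere_grad (R : realType) (n : nat) (u : 'rV[R]_n.+1 -> R)
    (x : 'rV[R]_n.+1) : 'rV[R]_n.+1 :=
  tangent_proj x (\row_i 'D_(delta_mx 0 i) (homog_ext 0 u) x).

(* Levi-Civita connection of a submanifold of Euclidean space: the covariant
   derivative of a tangent field V at x along the tangent vector xi is the
   tangential part of the ambient derivative of an extension of V. *)
Definition sphere_covD (R : realType) (n : nat)
    (V : 'rV[R]_n.+1 -> 'rV[R]_n.+1) (x xi : 'rV[R]_n.+1) : 'rV[R]_n.+1 :=
  tangent_proj x ('D_xi (V \o @radial_proj R n.+1) x).

Definition sphere_hess (R : realType) (n : nat) (u : 'rV[R]_n.+1 -> R)
    (x xi eta : 'rV[R]_n.+1) : R :=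
  edot (sphere_covD (sphere_grad u) x xi) eta.

(* Trace of the covariant Hessian over the tangent space at x: for a bilinear
   form B and the orthogonal projection P onto the tangent space, the sum of
   the B (P e_i) (P e_i) over the standard basis of R^(n+1) is the sum of the
   B t_j t_j over any orthonormal basis of the tangent space. *)
Definition laplace_beltrami (R : realType) (n : nat) (u : 'rV[R]_n.+1 -> R)
    (x : 'rV[R]_n.+1) : R :=
  \sum_(i < n.+1) sphere_hess u x (tangent_proj x (delta_mx 0 i))
                                  (tangent_proj x (delta_mx 0 i)).

(* Positive semidefiniteness of the covariant Hessian plus u times the metric
   on every tangent space. *)
Definition sphere_convex (R : realType) (n : nat) (u : 'rV[R]_n.+1 -> R) : Prop :=
  forall x xi : 'rV[R]_n.+1, unit_sphere x -> edot x xi = 0 ->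
    0 <= sphere_hess u x xi xi + u x * edot xi xi.

(* Main.v *)
(* The degree 1 extension U of u is C2 off the origin, its Laplacian is the
   degree -1 extension F of f, and at a point x of the sphere its Hessian
   restricted to the tangent space is the Hessian of u plus u times the metric.
   Fix a unit vector xi. Since F is Lipschitz along lines, the hypothesis makes
   F(z + t xi) + F(z - t xi) nonincreasing in t > 0 for z orthogonal to xi. Let
   Psi = U + U o s, s being the reflection in the hyperplane orthogonal to xi.
   The derivative of Psi along xi is homogeneous of degree 0, vanishes on the
   hyperplane and is formally superharmonic on the side of xi, hence nonnegative
   there. As Psi is only C2, the minimum principle is applied to the difference
   quotients (Psi(y + h xi) - Psi(y - h xi)) / 2h, whose Laplacian is nonpositive
   by the above monotonicity. Differentiating once more along xi at a point x of
   the hyperplane gives 2 D2U(x)(xi, xi) >= 0. *)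
From HB Require Import structures.
Require Import Defs.
From mathcomp Require Import all_boot all_order all_algebra.
From mathcomp Require Import all_classical all_reals all_analysis.
From mathcomp Require Import measurable_realfun ring lra.

Set Implicit Arguments.
Unset Strict Implicit.
Unset Printing Implicit Defensive.

Import Order.TTheory GRing.Theory Num.Theory.
Import numFieldNormedType.Exports.

Local Open Scope classical_set_scope.
Local Open Scope ring_scope.

(** * Lipschitz functions of one real variable *)

Lemma lebesgue_stieltjes_itvoc (R : realType) (G : cumulative R R) (a b : R) :
  a <= b -> lebesgue_stieltjes_measure G `]a, b] = (G b - G a)%:E.
Proof.
move=> ab; rewrite /lebesgue_stieltjes_measure /measure_extension.
by rewrite measurable_mu_extE/=; [rewrite wlength_itv_bnd|exact: is_ocitv].
Qed.

Section density.
Context (R : realType).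
Notation mu := (@lebesgue_measure R).

(** The Lipschitz bound keeps the Stieltjes measure of [G] below [K] times Lebesgue measure, which
    is the absolute continuity that Radon-Nikodym requires. *)
Lemma lipschitz_nondecreasing_dominates (K : R) (G : cumulative R R) :
  0 < K -> (forall x y, x <= y -> G y - G x <= K * (y - x)) ->
  lebesgue_stieltjes_measure G `<< mu.
Proof.
move=> K0 Glip.
(* The Stieltjes measures of G and of K x - G x add up to K times mu. *)
pose g' x := K * x - G x.
have g'nd : nondecreasing g'.
  by move=> x y xy; have := Glip _ _ xy; rewrite /g'; lra.
have Gc : right_continuous G by exact: cumulative_is_right_continuous.
have g'rc : right_continuous g'.
  move=> x; apply: (@cvgB _ R^o); last exact: Gc.
  by apply: cvgM; [exact: cvg_cst|apply: cvg_within_filter; exact: cvg_id].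
pose G' : cumulative R R := HB.pack g' (isCumulative.Build R _ R g' g'nd g'rc).
have iK : 0 <= K^-1 by rewrite invr_ge0 ltW.
pose nu := [the measure _ _ of measure_add
  (lebesgue_stieltjes_measure G) (lebesgue_stieltjes_measure G')].
pose nu1 := [the measure _ _ of mscale (NngNum iK) nu].
have E A : measurable A -> mu A = nu1 A.
  apply: lebesgue_measure_unique => X /ocitvP[->|[[a b] /= ab ->]].
    by rewrite !measure0.
  rewrite -[X in _ = (_ * X)%E]/(measure_add _ _ _) measure_addE.
  rewrite lebesgue_measure_itv/= lte_fin ab.
  rewrite !lebesgue_stieltjes_itvoc ?(ltW ab)// -!EFinD -EFinM; congr EFin.
  rewrite /G' /= /g' [X in _ * X](_ : _ = K * (b - a)) ?mulKf ?gt_eqF//.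
  by rewrite /=; ring.
apply/null_content_dominatesP => A mA.
rewrite [X in X = _ -> _](E A mA) /nu1/= /mscale /=.
rewrite -[X in (_ * X)%E = _ -> _]/(measure_add _ _ _) measure_addE => /eqP.
rewrite mule_eq0 eqe invr_eq0 gt_eqF//= padde_eq0// => /andP[/eqP + _].
by [].
Qed.

(** The density is the Radon-Nikodym derivative of the Stieltjes measure of [g] with respect to
    Lebesgue measure. *)
Lemma lipschitz_nondecreasing_density (K : R) (g : R -> R) (a b : R) :
  0 < K -> (forall x y, x <= y -> 0 <= g y - g x <= K * (y - x)) ->
  exists d : R -> R, mu.-integrable setT (EFin \o d) /\
    forall t, a <= t <= b -> g t = g a + \int[mu]_(x in `]a, t]) d x.
Proof.
move=> K0 glip.
have gnd : nondecreasing g.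
  by move=> x y xy; have /andP[+ _] := glip _ _ xy; rewrite subr_ge0.
have grc : right_continuous g.
  apply: right_continuousW => x; apply/cvgrPdist_le => e e0.
  near=> y.
  have : `|x - y| <= e / K.
    by near: y; apply: cvgr_dist_le; [exact: cvg_id|rewrite divr_gt0].
  rewrite ler_pdivlMr// mulrC; apply: le_trans.
  have [xy|yx] := leP x y.
    have /andP[h1 h2] := glip _ _ xy.
    by rewrite distrC [X in _ * X]distrC !ger0_norm ?subr_ge0 ?gnd.
  have /andP[h1 h2] := glip _ _ (ltW yx).
  by rewrite !ger0_norm ?subr_ge0 ?gnd// ltW.
pose G : cumulative R R := HB.pack g (isCumulative.Build R _ R g gnd grc).
have dom : lebesgue_stieltjes_measure G `<< mu.
  by apply: (@lipschitz_nondecreasing_dominates K) => // x y /glip /andP[].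
have [ab|ba] := leP a b; last first.
  exists (cst 0); split; first exact: integrable0.
  by move=> t /andP[at_ tb]; have := le_lt_trans (le_trans at_ tb) ba; rewrite ltxx.
have mI : measurable (`]a, b]%classic : set (measurableTypeR R)) by exact: measurable_itv.
have fI : (lebesgue_stieltjes_measure G `]a, b] < +oo)%E.
  by rewrite lebesgue_stieltjes_itvoc// ltry.
(* Restricting the Stieltjes measure to []a, b]] makes it finite. *)
have dom' : mfrestr mI fI `<< mu.
  apply/null_content_dominatesP => A mA A0.
  rewrite /mfrestr /mrestr; apply: subset_measure0 (_ : lebesgue_stieltjes_measure G A = 0%E) => //.
  - exact: measurableI.
  - exact: (null_content_dominatesP _ _).1 dom _ mA A0.
have [d [d0 dfin dint dE]] := radon_nikodym_sigma_finite dom'.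
have dEE : EFin \o (fine \o d) = d by apply/funext => x /=; rewrite fineK.
exists (fine \o d); split; first by rewrite dEE.
move=> t /andP[at_ tb]; rewrite /Rintegral.
have -> : (\int[mu]_(x in `]a, t]) ((fine \o d) x)%:E = (G t - G a)%:E)%E.
  rewrite -lebesgue_stieltjes_itvoc//.
  under eq_integral do rewrite [X in X%:E]/= fineK//.
  rewrite -dE ?/mfrestr ?/mrestr; last exact: measurable_itv.
  congr (lebesgue_stieltjes_measure G _); rewrite setIidl//.
  by apply: subset_itvl; rewrite bnd_simp.
by rewrite /= addrC subrK.
Unshelve. all: end_near. Qed.
End density.

Section lipschitz_monotone.
Context (R : realType).
Notation mu := (@lebesgue_measure R).

(** Adding [L * x] to [g] makes it nondecreasing, so that it has a density [d]; subtracting [L] from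
    [d] gives the density of [g]. Lebesgue differentiation of the integral identifies it with the
    derivative almost everywhere. *)
Lemma lipschitz_density (L : R) (g : R -> R) (a b : R) :
  a < b -> 0 <= L ->
  (forall x y, a <= x -> x <= y -> y <= b -> `|g y - g x| <= L * (y - x)) ->
  exists d : R -> R, [/\ mu.-integrable `]a, b] (EFin \o d),
    g b - g a = \int[mu]_(x in `]a, b]) d x &
    {ae mu, forall x, a < x < b -> is_derive x 1 g (d x)}].
Proof.
move=> ab L0 glip.
(* Clamping the argument to [[a, b]] turns the bounds on this interval into bounds on the whole
   line. *)
pose cl (t : R) := Num.max a (Num.min t b).
have cla t : a <= cl t by rewrite le_max lexx.
have clb t : cl t <= b by rewrite ge_max ltW//= ge_min lexx orbT.
have clE t : a <= t <= b -> cl t = t.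
  by move=> /andP[at_ tb]; rewrite /cl min_l// max_r.
have clnd x y : x <= y -> 0 <= cl y - cl x <= y - x.
  move=> xy; rewrite /cl /Num.max /Num.min.
  by case: ifPn; case: ifPn; case: ifPn; case: ifPn; rewrite -?leNgt; lra.
pose G t := g (cl t) + L * cl t.
(* [2 * L] is already a Lipschitz constant; the [1] makes it positive when [L] vanishes. *)
have K0 : 0 < 2 * L + 1 by lra.
have Glip x y : x <= y -> 0 <= G y - G x <= (2 * L + 1) * (y - x).
  move=> xy; have /andP[c0 c1] := clnd _ _ xy.
  have := glip (cl x) (cl y) (cla _) _ (clb _).
  rewrite -subr_ge0 => /(_ c0).
  rewrite ler_norml /G => /andP[h1 h2].
  have : L * (cl y - cl x) <= L * (y - x) by rewrite ler_wpM2l.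
  by move: h1 h2; rewrite !mulrBr mulrDl mul1r -!mulrA; lra.
have [d [dint dE]] := @lipschitz_nondecreasing_density R _ G a b K0 Glip.
have dint' : mu.-integrable `]a, b] (EFin \o d).
  exact: integrableS dint.
have Lint : mu.-integrable `]a, b] (EFin \o cst L).
  apply: measurable_bounded_integrable => //.
    by rewrite /= lebesgue_measure_itv/= lte_fin ab ltry.
  exact: bounded_cst.
exists (fun x => d x - L); split.
- by rewrite (_ : EFin \o _ = ((EFin \o d) \- (EFin \o cst L))%E)//; exact: integrableB.
- rewrite RintegralB//.
  have := dE b; rewrite lexx (ltW ab) => /(_ isT).
  move=> h.
  have muab : mu `]a, b] = (b - a)%:E.
    by rewrite lebesgue_measure_itv/= lte_fin ab.
  rewrite Rintegral_cst// [X in fine X]muab /=.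
  by move: h; rewrite /G !clE ?lexx ?(ltW ab)//; lra.
- have dloc : locally_integrable [set: R] d.
    by apply: open_integrable_locally => //; exact: openT.
  have dint2 y : mu.-integrable [set` Interval (BRight a) (BRight y)] (EFin \o d).
    exact: integrableS dint.
  have := FTC1 dint2 dloc.
  apply: filterS; first exact: (ae_filter_ringOfSetsType mu).
  move=> x /[swap] /andP[ax xb]; rewrite lte_fin => /(_ ax)[dF DF].
  have isF : is_derive x 1
      (fun t => \int[mu]_(t in `]a, t]) d t + (- L * t + (g a + L * a))) (d x - L).
    apply: is_deriveD.
      by apply: DeriveDef; [exact: dF|rewrite -derive1E DF].
    rewrite -[X in is_derive _ _ _ X]addr0; apply: is_deriveD.
    rewrite -[X in is_derive _ _ _ X]mulr1.
    exact: (@is_deriveZ _ _ _ id).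
  have E : \forall t \near x,
      \int[mu]_(t in `]a, t]) d t + (- L * t + (g a + L * a)) = g t.
    near=> t.
    have tab : a <= t <= b by apply/andP; split; near: t;
      [exact: lt_le_nbhsr|exact: lt_le_nbhsl].
    have := dE _ tab; rewrite /G !clE ?lexx ?(ltW ab)//; lra.
  apply: DeriveDef.
    apply: near_eq_derivable E _; exact: ex_derive.
  by rewrite -(near_eq_derive _ E) derive_val.
Unshelve. all: end_near. Qed.

(** Both increments are integrals of almost everywhere derivatives, so a sign condition at the
    points where both derivatives exist is enough. *)
Lemma lipschitz_derive_le0 (L : R) (f g : R -> R) (a b : R) :
  a < b -> 0 <= L ->
  (forall x y, a <= x -> x <= y -> y <= b -> `|f y - f x| <= L * (y - x)) ->
  (forall x y, a <= x -> x <= y -> y <= b -> `|g y - g x| <= L * (y - x)) ->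
  (forall x df dg, a < x < b -> is_derive x 1 f df -> is_derive x 1 g dg ->
     df + dg <= 0) ->
  f b + g b <= f a + g a.
Proof.
move=> ab L0 /(lipschitz_density ab L0)[df [dfi fE fD]].
move=> /(lipschitz_density ab L0)[dg [dgi gE gD]] fg0.
suff : 0 <= \int[mu]_(x in `]a, b]) (- (df x + dg x)).
  have dfgi : mu.-integrable `]a, b] (EFin \o (fun x => df x + dg x)).
    rewrite (_ : EFin \o _ = ((EFin \o df) \+ (EFin \o dg))%E)//.
    exact: integrableD.
  under eq_Rintegral do rewrite -mulN1r.
  rewrite RintegralZl// RintegralD// -fE -gE; lra.
pose e (x : R) := - (df x + dg x).
have me : measurable_fun (`]a, b]%classic : set (measurableTypeR R)) e.
  apply: measurableT_comp => //; apply: measurable_funD;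
  by apply/measurable_EFinP; apply: (measurable_int mu).
(* The integrand is nonnegative almost everywhere only; replacing it by its positive part makes it
   so everywhere. The endpoint [b] is discarded because the derivatives are controlled on the open
   interval. *)
have -> : \int[mu]_(x in `]a, b]) e x = \int[mu]_(x in `]a, b]) Num.max (e x) 0.
  rewrite /Rintegral; congr fine; apply: ae_eq_integral => //.
  - exact/measurable_EFinP.
  - by apply/measurable_EFinP; apply: measurable_maxr.
  - have bN : {ae mu, forall x, x != b}.
      exists [set b]; split => //; first exact: lebesgue_measure_set1.
      by move=> x /= /negP; rewrite negbK => /eqP.
    have F := ae_filter_ringOfSetsType mu.
    apply: filterS3 fD gD bN => x fD gD bN; rewrite /= in_itv/= => /andP[ax xb].
    have axb : a < x < b by rewrite ax lt_neqAle bN.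
    congr EFin; rewrite max_l// oppr_ge0.
    exact: fg0 axb (fD axb) (gD axb).
apply: Rintegral_ge0 => x _.
by rewrite le_max lexx orbT.
Qed.
End lipschitz_monotone.

(** * Monotonicity of the extension of f along lines *)

Section euclidean.
Context (R : realType) (m : nat).
Implicit Types x y z : 'rV[R]_m.

Lemma edotC x y : edot x y = edot y x.
Proof. by apply: eq_bigr => i _; rewrite mulrC. Qed.

Lemma edotDr x y z : edot x (y + z) = edot x y + edot x z.
Proof. by rewrite -big_split; apply: eq_bigr => i _; rewrite mxE mulrDr. Qed.

Lemma edotZr c x y : edot x (c *: y) = c * edot x y.
Proof. by rewrite mulr_sumr; apply: eq_bigr => i _; rewrite mxE mulrCA. Qed.

Lemma edotNr x y : edot x (- y) = - edot x y.
Proof. by rewrite -scaleN1r edotZr mulN1r. Qed.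

Lemma edotBr x y z : edot x (y - z) = edot x y - edot x z.
Proof. by rewrite edotDr edotNr. Qed.

Lemma edotDl x y z : edot (x + y) z = edot x z + edot y z.
Proof. by rewrite edotC edotDr !(edotC z). Qed.

Lemma edotZl c x y : edot (c *: x) y = c * edot x y.
Proof. by rewrite edotC edotZr edotC. Qed.

Lemma edotNl x y : edot (- x) y = - edot x y.
Proof. by rewrite edotC edotNr edotC. Qed.

Lemma edotBl x y z : edot (x - y) z = edot x z - edot y z.
Proof. by rewrite edotDl edotNl. Qed.

Definition edotE := (edotDr, edotDl, edotNr, edotNl, edotZr, edotZl).

Lemma edot0r x : edot x 0 = 0.
Proof. by rewrite -(scale0r 0) edotZr mul0r. Qed.

Lemma edot0l x : edot 0 x = 0.
Proof. by rewrite edotC edot0r. Qed.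

Lemma edot_deltar x i : edot x (delta_mx 0 i) = x 0 i.
Proof.
rewrite /edot (bigD1 i)//= big1 ?addr0 ?mxE ?eqxx ?mulr1// => j ji.
by rewrite mxE (negbTE ji) mulr0.
Qed.

Lemma edot_ge0 x : 0 <= edot x x.
Proof. by apply: sumr_ge0 => i _; rewrite -expr2 sqr_ge0. Qed.

Lemma sqr_coord_le_edot x i : x 0 i ^+ 2 <= edot x x.
Proof.
by rewrite /edot (bigD1 i)//= -expr2 lerDl sumr_ge0// => j _; rewrite -expr2 sqr_ge0.
Qed.

Lemma edot_eq0 x : (edot x x == 0) = (x == 0).
Proof.
apply/eqP/eqP => [x0|->]; last exact: edot0r.
apply/rowP => i; apply/eqP; rewrite mxE -sqrf_eq0 eq_le sqr_ge0 andbT.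
by rewrite -x0 sqr_coord_le_edot.
Qed.

Lemma edot_gt0 x : x != 0 -> 0 < edot x x.
Proof. by move=> x0; rewrite lt_neqAle edot_ge0 eq_sym edot_eq0 x0. Qed.

Lemma enorm_ge0 x : 0 <= enorm x.
Proof. exact: sqrtr_ge0. Qed.

Lemma sqr_enorm x : enorm x ^+ 2 = edot x x.
Proof. by rewrite sqr_sqrtr// edot_ge0. Qed.

Lemma enorm_gt0 x : x != 0 -> 0 < enorm x.
Proof. by move=> /edot_gt0; rewrite sqrtr_gt0. Qed.

Lemma enormZ c x : enorm (c *: x) = `|c| * enorm x.
Proof.
by rewrite /enorm edotZr edotZl mulrA -expr2 sqrtrM ?sqr_ge0// sqrtr_sqr.
Qed.

Lemma enorm_radial x : x != 0 -> enorm (radial_proj x) = 1.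
Proof.
move=> /enorm_gt0 x0; rewrite /radial_proj enormZ gtr0_norm ?invr_gt0//.
by rewrite mulVf// gt_eqF.
Qed.

Lemma enorm_radialK x : x != 0 -> enorm x *: radial_proj x = x.
Proof.
by move=> /enorm_gt0 x0; rewrite /radial_proj scalerA mulfV ?gt_eqF// scale1r.
Qed.

Lemma radial_projZ c x : 0 < c -> radial_proj (c *: x) = radial_proj x.
Proof.
move=> c0; rewrite /radial_proj enormZ gtr0_norm// scalerA invfM mulrAC.
by rewrite mulVf ?mul1r ?gt_eqF.
Qed.

(** Links the sup norm, in which balls and the Lipschitz condition are expressed, to the Euclidean
    norm that defines the sphere. *)
Lemma normr_le_enorm x : `|x| <= enorm x.
Proof.
rewrite /Num.norm/= mx_normrE; apply: bigmax_le; first exact: enorm_ge0.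
move=> -[i j] _ /=; rewrite ord1 -sqrtr_sqr ler_wsqrtr//.
exact: sqr_coord_le_edot.
Qed.

End euclidean.

Lemma unit_sphere_edot (R : realType) (n : nat) (x : 'rV[R]_n.+1) :
  unit_sphere x -> edot x x = 1.
Proof. by rewrite -sqr_enorm => ->; rewrite expr1n. Qed.

Lemma unit_sphere_neq0 (R : realType) (n : nat) (x : 'rV[R]_n.+1) :
  unit_sphere x -> x != 0.
Proof. by move=> /unit_sphere_edot x1; rewrite -edot_eq0 x1 oner_eq0. Qed.

(** * Directional derivatives as derivatives along a line *)

Section line_derivative.
Context (R : realType) (V W : normedModType R).

(** The two difference quotients are the same function of [h], so existence and value of the
    derivative transfer together. *)
Let line_quotient (G : V -> W) (z v : V) (s : R) :
  (fun h => h^-1 *: (((fun s : R => G (z + s *: v)) \o shift s) (h *: (1 : R))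
     - G (z + s *: v))) =
  (fun h => h^-1 *: ((G \o shift (z + s *: v)) (h *: v) - G (z + s *: v))).
Proof.
apply/funext => h /=; congr (_ *: (G _ - _)).
by rewrite [h *: 1]mulr1 scalerDl addrCA.
Qed.

Lemma derivable_line (G : V -> W) (z v : V) (s : R) :
  derivable (fun s : R => G (z + s *: v)) s 1 <-> derivable G (z + s *: v) v.
Proof. by rewrite /derivable line_quotient. Qed.

Lemma derive_line (G : V -> W) (z v : V) (s : R) :
  'D_1 (fun s : R => G (z + s *: v)) s = 'D_v G (z + s *: v).
Proof. by rewrite /derive line_quotient. Qed.

Lemma is_derive_line (G : V -> W) (z v : V) (s : R) d :
  is_derive s 1 (fun s : R => G (z + s *: v)) d <-> is_derive (z + s *: v) v G d.
Proof.
by split=> -[dG <-]; split; rewrite ?derive_line//; apply/derivable_line.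
Qed.

End line_derivative.

(** * The degree -1 extension along lines *)

Section homog_ext_line.
Context (R : realType) (n : nat).
Implicit Types z xi : 'rV[R]_n.+1.

Lemma enorm_line z xi (s : R) : unit_sphere xi -> edot xi z = 0 ->
  enorm (z + s *: xi) = Num.sqrt (edot z z + s ^+ 2).
Proof.
move=> xi1 xiz; rewrite /enorm !edotE (edotC z) xiz (unit_sphere_edot xi1).
by congr Num.sqrt; ring.
Qed.

(** For [s >= a] the point [z + s *: xi] has norm at least [a]. There the inverse norm is Lipschitz
    with constant [1 / a ^+ 2] and the radial projection with constant [2 / a], while [f] is bounded
    and Lipschitz on the sphere. *)
Lemma homog_ext_line_lipschitz (f : 'rV[R]_n.+1 -> R) z xi (a : R) :
  [lipschitz f x | x in @unit_sphere R n] -> unit_sphere xi ->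
  edot xi z = 0 -> 0 < a ->
  exists2 L, 0 <= L & forall x y : R, a <= x -> x <= y ->
    `|homog_ext (-1) f (z + y *: xi) - homog_ext (-1) f (z + x *: xi)|
      <= L * (y - x).
Proof.
move=> flip xi1 xiz a0.
have [M [M0 fM]] : exists M, 0 < M /\ forall x y, unit_sphere x -> unit_sphere y ->
    `|f x - f y| <= M * `|x - y|.
  near (+oo : set_system R) => M; exists M; split=> [|x y x1 y1].
    by near: M; exact: nbhs_pinfty_gt.
  suff : M.-lipschitz_(@unit_sphere R n) f by move=> /(_ (x, y)); exact.
  by near: M.
(* Two unit vectors are at sup distance at most 2, so the Lipschitz condition bounds [f] on the
   sphere. *)
have B w : unit_sphere w -> `|f w| <= `|f xi| + M * 2.
  move=> w1; rewrite -[f w](subrK (f xi)) addrC.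
  apply: le_trans (ler_normD _ _) _; rewrite lerD2l.
  apply: le_trans (fM _ _ w1 xi1) _; rewrite ler_pM2l//.
  apply: le_trans (ler_normB _ _) _.
  rewrite -[2]/(1 + 1); apply: lerD;
  by apply: le_trans (normr_le_enorm _) _; rewrite ?w1 ?xi1.
pose r s := enorm (z + s *: xi).
have r2 s : r s ^+ 2 = edot z z + s ^+ 2.
  by rewrite /r enorm_line// sqr_sqrtr// addr_ge0 ?edot_ge0 ?sqr_ge0.
have rs s : 0 < s -> s <= r s.
  move=> s0; rewrite -(@ler_pXn2r _ 2) ?nnegrE ?enorm_ge0 ?(ltW s0)//.
  by rewrite r2 lerDr edot_ge0.
(* [r y ^+ 2 - r x ^+ 2] equals [y ^+ 2 - x ^+ 2], and [x + y <= r x + r y]. *)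
have rlip x y : 0 < x -> x <= y -> 0 <= r y - r x <= y - x.
  move=> x0 xy; have := rs _ x0; have := rs _ (lt_le_trans x0 xy).
  have : r y ^+ 2 - r x ^+ 2 = y ^+ 2 - x ^+ 2 by rewrite !r2; ring.
  by rewrite !subr_sqr => *; apply/andP; split; nra.
pose C := (`|f xi| + M * 2) / a ^+ 2 + M * 2 / a ^+ 2.
exists C => [|x y ax xy].
  have M2 : 0 <= M * 2 by rewrite mulr_ge0 ?(ltW M0).
  by rewrite addr_ge0 ?divr_ge0 ?addr_ge0 ?sqr_ge0.
have x0 : 0 < x by exact: lt_le_trans ax.
have y0 : 0 < y by exact: lt_le_trans xy.
have rx0 : a <= r x by exact: le_trans (rs _ x0).
have ry0 : a <= r y by exact: le_trans (le_trans ax xy) (rs _ y0).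
have rxp : 0 < r x by exact: lt_le_trans rx0.
have ryp : 0 < r y by exact: lt_le_trans ry0.
have px : z + x *: xi != 0 by rewrite -edot_eq0 -sqr_enorm expf_neq0 ?gt_eqF.
have py : z + y *: xi != 0 by rewrite -edot_eq0 -sqr_enorm expf_neq0 ?gt_eqF.
(* The factor [r x] is kept in the denominator to cancel the norm of [z + x *: xi] in the bound
   [rad]. *)
have rinv : `|(r y)^-1 - (r x)^-1| <= (y - x) / (a * r x).
  have -> : (r y)^-1 - (r x)^-1 = - (r y - r x) / (r y * r x).
    by field; rewrite !gt_eqF.
  have /andP[h0 h1] := rlip _ _ x0 xy.
  rewrite normrM normrN (ger0_norm h0) gtr0_norm ?invr_gt0 ?mulr_gt0//.
  apply: ler_pM => //; first by rewrite invr_ge0 ltW// mulr_gt0.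
  by rewrite lef_pV2 ?posrE ?mulr_gt0// ler_pM2r.
have rinva : (y - x) / (a * r x) <= (y - x) / a ^+ 2.
  rewrite ler_wpM2l ?subr_ge0// lef_pV2 ?posrE ?mulr_gt0 ?exprn_gt0//.
  by rewrite expr2 ler_pM2l.
have rad : `|radial_proj (z + y *: xi) - radial_proj (z + x *: xi)|
    <= 2 * (y - x) / a.
  have -> : radial_proj (z + y *: xi) - radial_proj (z + x *: xi) =
    ((r y)^-1 * (y - x)) *: xi + ((r y)^-1 - (r x)^-1) *: (z + x *: xi).
    rewrite /radial_proj -/(r y) -/(r x); apply/rowP => i; rewrite !mxE; ring.
  apply: le_trans (ler_normD _ _) _; rewrite -[2]/(1 + 1) -mulrA mulrDl.
  apply: lerD; rewrite normrZ mul1r.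
    rewrite -[leRHS]mulr1; apply: ler_pM => //.
      rewrite normrM gtr0_norm ?invr_gt0// ger0_norm ?subr_ge0// mulrC.
      by rewrite ler_wpM2l ?subr_ge0// lef_pV2 ?posrE.
    by apply: le_trans (normr_le_enorm _) _; rewrite xi1.
  have -> : (y - x) / a = (y - x) / (a * r x) * r x by field; rewrite !gt_eqF.
  by apply: ler_pM => //; exact: normr_le_enorm.
have -> : homog_ext (-1) f (z + y *: xi) - homog_ext (-1) f (z + x *: xi)
    = ((r y)^-1 - (r x)^-1) * f (radial_proj (z + y *: xi)) +
      (r x)^-1 * (f (radial_proj (z + y *: xi)) - f (radial_proj (z + x *: xi))).
  by rewrite /homog_ext -/(r y) -/(r x) !exprN1; ring.
rewrite [leRHS]mulrDl; apply: le_trans (ler_normD _ _) _; apply: lerD.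
  rewrite normrM mulrC mulrAC -mulrA; apply: ler_pM => //.
    by apply: B; exact: enorm_radial.
  exact: le_trans rinva.
rewrite normrM gtr0_norm ?invr_gt0//.
have -> : M * 2 / a ^+ 2 * (y - x) = a^-1 * (M * (2 * (y - x) / a)).
  by field; rewrite gt_eqF.
apply: ler_pM => //; first by rewrite invr_ge0 ltW.
  by rewrite lef_pV2 ?posrE.
apply: le_trans (fM _ _ (enorm_radial py) (enorm_radial px)) _.
by rewrite ler_pM2l.
Unshelve. all: end_near. Qed.

(** The two terms are the restrictions of the extension to two opposite half-lines. The derivative
    of the second one is minus a derivative along [xi], so the hypothesis bounds the sum of the two
    derivatives by 0 wherever both exist. *)
Lemma homog_ext_reflect_nonincreasing (f : 'rV[R]_n.+1 -> R) z xi (a b : R) :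
  [lipschitz f x | x in @unit_sphere R n] -> unit_sphere xi ->
  edot xi z = 0 -> 0 < a -> a <= b ->
  (forall t : R, 0 < t ->
     derivable (homog_ext (-1) f) (z + t *: xi) xi ->
     derivable (homog_ext (-1) f) (z - t *: xi) xi ->
     'D_xi (homog_ext (-1) f) (z + t *: xi)
       - 'D_xi (homog_ext (-1) f) (z - t *: xi) <= 0) ->
  homog_ext (-1) f (z + b *: xi) + homog_ext (-1) f (z - b *: xi) <=
  homog_ext (-1) f (z + a *: xi) + homog_ext (-1) f (z - a *: xi).
Proof.
move=> flip xi1 xiz a0; rewrite le_eqVlt => /predU1P[->//|ab] fcond.
have Nxi1 : unit_sphere (- xi).
  by rewrite /unit_sphere /= -scaleN1r enormZ normrN1 mul1r.
have Nxiz : edot (- xi) z = 0 by rewrite edotNl xiz oppr0.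
have [L1 L10 lip1] := homog_ext_line_lipschitz flip xi1 xiz a0.
have [L2 L20 lip2] := homog_ext_line_lipschitz flip Nxi1 Nxiz a0.
have L0 : 0 <= L1 + L2 by rewrite addr_ge0.
pose F := homog_ext (-1) f.
have := @lipschitz_derive_le0 _ _ (fun s : R => F (z + s *: xi))
  (fun s : R => F (z + s *: (- xi))) _ _ ab L0.
rewrite !scalerN; apply=> [x y ax xy _|x y ax xy _|x df dg /andP[ax xb]].
- apply: le_trans (lip1 _ _ ax xy) _.
  by rewrite ler_wpM2r ?subr_ge0// lerDl.
- apply: le_trans (lip2 _ _ ax xy) _.
  by rewrite ler_wpM2r ?subr_ge0// lerDr.
move=> /is_derive_line[dF <-] Fg.
have x0 : 0 < x by exact: lt_trans ax.
(* The derivative along [- xi] at parameter [x] becomes one along [xi] at parameter [- x], the form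
   in which the hypothesis is stated. *)
have /is_derive_line : is_derive (- x) 1 (fun s : R => F (z + s *: xi)) (dg * - 1).
  have -> : (fun s : R => F (z + s *: xi)) =
      (fun s : R => F (z + s *: (- xi))) \o -%R.
    by apply/funext => s /=; rewrite scalerN scaleNr opprK.
  by apply: is_derive1_comp; rewrite opprK.
rewrite scaleNr mulrN1 => -[dF' EF'].
by have := fcond x x0 dF dF'; rewrite EF' opprK.
Qed.

End homog_ext_line.

(** * Homogeneous extensions of C2 functions on the sphere *)

Section pointwise_derive.
Context (R : realType) (V : normedModType R).
Implicit Types (f g : V -> R) (x v : V).

Lemma is_derive_at f x v (d : R) :
  is_derive (0 : R) (1 : R) (fun s : R => f (x + s *: v)) d <-> is_derive x v f d.
Proof.
have := is_derive_line f x v 0 d.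
by rewrite scale0r addr0.
Qed.

Lemma is_derive_add f g x v a b : is_derive x v f a -> is_derive x v g b ->
  is_derive x v (fun y => f y + g y) (a + b).
Proof. by move=> fa gb; exact: is_deriveD. Qed.

Lemma is_derive_sub f g x v a b : is_derive x v f a -> is_derive x v g b ->
  is_derive x v (fun y => f y - g y) (a - b).
Proof. by move=> fa gb; exact: is_deriveB. Qed.

Lemma is_derive_mul f g x v a b : is_derive x v f a -> is_derive x v g b ->
  is_derive x v (fun y => f y * g y) (f x * b + g x * a).
Proof. by move=> fa gb; exact: is_deriveM. Qed.

Lemma is_derive_mulC c f x v a : is_derive x v f a ->
  is_derive x v (fun y => c * f y) (c * a).
Proof. by move=> fa; exact: is_deriveZ. Qed.

Lemma is_derive_comp1 (h : R -> R) f x v (a b : R) :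
  is_derive (f x) (1 : R) h a -> is_derive x v f b ->
  is_derive x v (fun y => h (f y)) (a * b).
Proof.
move=> ha /is_derive_at fb; apply/is_derive_at.
by apply: (@is_derive1_comp _ h (fun s : R => f (x + s *: v)));
  rewrite ?scale0r ?addr0.
Qed.

Lemma is_derive_inv f x v a : f x != 0 -> is_derive x v f a ->
  is_derive x v (fun y => (f y)^-1) (- (f x) ^- 2 * a).
Proof.
move=> fx0; apply: (@is_derive_comp1 (fun t => t^-1)).
apply: is_derive_eq; first by apply: (@is_deriveV _ id).
by rewrite /= [_ *: _]mulr1.
Qed.

Lemma near_is_derive f g x v d : (\forall y \near x, f y = g y) ->
  is_derive x v f d -> is_derive x v g d.
Proof.
move=> fg [df <-]; split; first exact: near_eq_derivable fg df.
by rewrite (near_eq_derive _ fg).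
Qed.

End pointwise_derive.

(** The chain rule through the scaling by [c]: differentiation lowers the degree of homogeneity by
    one. The relation is assumed near [x] only, since for derivatives of the extensions it is
    available off the origin. *)
Lemma is_derive_homog (R : realType) (V : normedModType R)
    (f : V -> R) (x v : V) (c a d : R) : 0 < c ->
  (\forall y \near x, f (c *: y) = a * f y) ->
  is_derive x v f d -> is_derive (c *: x) v f (a / c * d).
Proof.
move=> c0 fc fd.
have : is_derive x v (fun y => f (c *: y)) (a * d).
  by apply: near_is_derive (is_derive_mulC a fd); near=> y; rewrite (near fc y).
move=> /is_derive_at fcd; apply/is_derive_at.
have -> : (fun s : R => f (c *: x + s *: v)) =
    (fun s : R => f (c *: (x + s *: v))) \o (fun s => s / c).
  apply/funext => s /=; rewrite scalerDr scalerA mulrCA mulfV ?gt_eqF//.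
  by rewrite mulr1.
rewrite mulrAC; apply: is_derive1_comp; first by rewrite mul0r.
rewrite -[X in is_derive _ _ _ X]mulr1 (_ : (fun s : R => s / c) = (fun s => c^-1 * s)).
  by apply: is_derive_mulC; exact: is_derive_id.
by apply/funext => s; rewrite mulrC.
Unshelve. all: end_near. Qed.

(** * Derivatives and continuity of the Euclidean norm *)

Section enorm_derive.
Context (R : realType) (m : nat).
Implicit Types x y v w : 'rV[R]_m.

Lemma is_derive_edot v x w : is_derive x w (fun y => edot y v) (edot w v).
Proof.
apply/is_derive_at.
have -> : (fun s : R => edot (x + s *: w) v) =
    (fun s : R => edot x v + edot w v * s).
  by apply/funext => s; rewrite !edotE mulrC.
rewrite -[X in is_derive _ _ _ X]add0r -[X in _ + X]mulr1.
by apply: is_derive_add; apply: is_derive_mulC.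
Qed.

Lemma is_derive_edot_diag x w :
  is_derive x w (fun y => edot y y) (2 * edot x w).
Proof.
apply/is_derive_at.
have -> : (fun s : R => edot (x + s *: w) (x + s *: w)) =
    (fun s : R => edot x x + (2 * edot x w) * s + edot w w * (s * s)).
  by apply/funext => s; rewrite !edotE (edotC w x); ring.
rewrite [X in is_derive _ _ _ X](_ : _ =
  0 + 2 * edot x w * 1 + edot w w * (0 * 1 + 0 * 1)); last by ring.
exact: (is_derive_add
  (is_derive_add (is_derive_cst _ _ _) (is_derive_mulC _ (is_derive_id _ _)))
  (is_derive_mulC _ (is_derive_mul (is_derive_id _ _) (is_derive_id _ _)))).
Qed.

Lemma is_derive_enorm x w : x != 0 ->
  is_derive x w (@enorm R m) (edot x w / enorm x).
Proof.
move=> x0; have dxx := is_derive_edot_diag x w.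
have -> : edot x w / enorm x = (2 * Num.sqrt (edot x x))^-1 * (2 * edot x w).
  by rewrite -/(enorm x); field; rewrite gt_eqF ?enorm_gt0.
by apply: is_derive_comp1; apply: is_derive1_sqrt; exact: edot_gt0.
Qed.

Lemma continuous_edot v : continuous (fun y => edot y v).
Proof.
apply: (@continuous_big R _ +%R 0 _ _ _ _ (fun i (y : 'rV[R]_m) => y 0 i * v 0 i)).
  exact: add_continuous.
move=> i _ x; apply: (@continuousM _ 'rV[R]_m (fun y => y 0 i) (fun=> v 0 i)).
  exact: coord_continuous.
exact: cst_continuous.
Qed.

Lemma continuous_edot_diag : continuous (fun x : 'rV[R]_m => edot x x).
Proof.
apply: (@continuous_big R _ +%R 0 _ _ _ _ (fun i (y : 'rV[R]_m) => y 0 i * y 0 i)).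
  exact: add_continuous.
move=> i _ x; apply: (@continuousM _ 'rV[R]_m (fun y => y 0 i) (fun y => y 0 i));
  exact: coord_continuous.
Qed.

Lemma continuous_enorm : continuous (@enorm R m).
Proof.
move=> x; apply: (@cvg_comp _ _ _ (fun y => edot y y) Num.sqrt).
  exact: continuous_edot_diag.
exact: sqrt_continuous.
Qed.

End enorm_derive.

Lemma homog_extZ (R : realType) (m : nat) (k : int) (u : 'rV[R]_m -> R) c y :
  0 < c -> homog_ext k u (c *: y) = c ^ k * homog_ext k u y.
Proof.
move=> c0; rewrite /homog_ext enormZ radial_projZ// gtr0_norm//.
by rewrite expfzMl mulrA.
Qed.

Lemma homog_ext1E (R : realType) (m : nat) (u : 'rV[R]_m -> R) y :
  homog_ext 1 u y = enorm y * homog_ext 0 u y.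
Proof. by rewrite /homog_ext expr1z expr0z mul1r. Qed.

Lemma near_neq0 (R : realType) (m : nat) (x : 'rV[R]_m) :
  x != 0 -> \forall y \near x, y != 0.
Proof. by move=> x0; exact: (@cvgr_neq0 _ _ _ (nbhs x) _ id x (@cvg_id _ _) x0). Qed.

(** * Calculus for the extensions of degree 0 and 1 *)

Section sphere_C2_calculus.
Context (R : realType) (n : nat) (u : 'rV[R]_n.+1 -> R).
Hypothesis u_C2 : sphere_C2 u.
Implicit Types x y v w xi eta : 'rV[R]_n.+1.
Local Notation U0 := (homog_ext 0 u).
Local Notation U := (homog_ext 1 u).
Local Notation e i := (delta_mx (0 : 'I_1) i).

Lemma is_derive_ext0 x v : x != 0 -> is_derive x v U0 ('D_v U0 x).
Proof.
by move=> /u_C2[dU _]; apply: DeriveDef => //; exact: diff_derivable.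
Qed.

Lemma is_derive2_ext0 x v w : x != 0 ->
  is_derive x w ('D_v U0) ('D_w ('D_v U0) x).
Proof.
by move=> /u_C2[_ [/(_ v) dU _]]; apply: DeriveDef => //; exact: diff_derivable.
Qed.

Lemma derive_ext0_linear x a v w : x != 0 ->
  'D_(a *: v + w) U0 x = a * 'D_v U0 x + 'D_w U0 x.
Proof. by move=> /u_C2[dU _]; rewrite !deriveE// linearP. Qed.

Lemma derive2_ext0_linearr x a v w z : x != 0 ->
  'D_(a *: v + w) ('D_z U0) x = a * 'D_v ('D_z U0) x + 'D_w ('D_z U0) x.
Proof. by move=> /u_C2[_ [/(_ z) dU _]]; rewrite !deriveE// linearP. Qed.

(** Linearity in the inner direction comes from linearity of the first derivative at all points near
    [x]; in the outer direction it is differentiability at [x] itself. *)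
Lemma derive2_ext0_linearl x a v w z : x != 0 ->
  'D_z ('D_(a *: v + w) U0) x = a * 'D_z ('D_v U0) x + 'D_z ('D_w U0) x.
Proof.
move=> x0; apply: derive_val.
have := is_derive_add (is_derive_mulC a (is_derive2_ext0 v z x0))
  (is_derive2_ext0 w z x0).
apply: near_is_derive; near=> y; rewrite derive_ext0_linear//; near: y; exact: near_neq0.
Unshelve. all: end_near. Qed.

Lemma derive_ext0Z c x v : 0 < c -> x != 0 ->
  'D_v U0 (c *: x) = c^-1 * 'D_v U0 x.
Proof.
move=> c0 x0; apply: derive_val; rewrite -[c^-1]mul1r.
apply: is_derive_homog (is_derive_ext0 v x0) => //.
by near=> y; rewrite homog_extZ// expr0z.
Unshelve. all: end_near. Qed.

Lemma derive2_ext0Z c x v w : 0 < c -> x != 0 ->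
  'D_w ('D_v U0) (c *: x) = c ^- 2 * 'D_w ('D_v U0) x.
Proof.
move=> c0 x0; apply: derive_val; rewrite expr2 invfM.
apply: is_derive_homog (is_derive2_ext0 v w x0) => //.
by near=> y; rewrite derive_ext0Z//; near: y; exact: near_neq0.
Unshelve. all: end_near. Qed.

Let near_add1_gt0 : \forall s \near (0 : R), 0 < 1 + s.
Proof.
have : \forall s \near (0 : R), -1 < s by apply: lt_nbhsr; lra.
by apply: filterS => s; lra.
Qed.

Lemma derive_ext0_radial x : x != 0 -> 'D_x U0 x = 0.
Proof.
move=> x0; apply: derive_val; apply/is_derive_at.
apply: near_is_derive (is_derive_cst (U0 x) _ _).
near=> s; rewrite -{2}[x]scale1r -scalerDl homog_extZ ?expr0z ?mul1r//.
by near: s; exact: near_add1_gt0.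
Unshelve. all: end_near. Qed.

(** By homogeneity, the vanishing of ['D_x U0] at [x] propagates along the ray of [x]. *)
Lemma derive2_ext0_radial x : x != 0 -> 'D_x ('D_x U0) x = 0.
Proof.
move=> x0; apply: derive_val; apply/is_derive_at.
apply: near_is_derive (is_derive_cst 0 _ _).
near=> s; rewrite -{1}[x]scale1r -scalerDl derive_ext0Z//.
  by rewrite derive_ext0_radial// mulr0.
by near: s; exact: near_add1_gt0.
Unshelve. all: end_near. Qed.

(** The Hessian of the product of the norm and [U0], written out by the product rule. [sphere_C2]
    speaks of [U0], and bilinearity, trace and continuity of the Hessian of [U] are read off from
    this formula. *)
Definition hess_ext1 x v w :=
  (edot v w / enorm x - edot x v * edot x w / enorm x ^+ 3) * U0 x
  + edot x v / enorm x * 'D_w U0 x + edot x w / enorm x * 'D_v U0 x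
  + enorm x * 'D_w ('D_v U0) x.

Lemma is_derive_ext1 x v : x != 0 ->
  is_derive x v U (edot x v / enorm x * U0 x + enorm x * 'D_v U0 x).
Proof.
move=> x0; rewrite (_ : U = (fun y => enorm y * U0 y)); last first.
  by apply/funext => y; exact: homog_ext1E.
rewrite addrC [X in _ + X]mulrC.
exact: is_derive_mul (is_derive_enorm v x0) (is_derive_ext0 v x0).
Qed.

Lemma is_derive2_ext1 x v w : x != 0 ->
  is_derive x w ('D_v U) (hess_ext1 x v w).
Proof.
move=> x0.
have r0 : enorm x != 0 by rewrite gt_eqF ?enorm_gt0.
apply: (@near_is_derive _ _
    (fun y => edot y v * (enorm y)^-1 * U0 y + enorm y * 'D_v U0 y)).
  near=> y; apply/esym; apply: derive_val; apply: is_derive_ext1.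
  by near: y; exact: near_neq0.
have dr := is_derive_enorm w x0.
have := is_derive_add
  (is_derive_mul
    (is_derive_mul (is_derive_edot v x w) (is_derive_inv r0 dr))
    (is_derive_ext0 w x0))
  (is_derive_mul dr (is_derive2_ext0 v w x0)).
rewrite [X in is_derive _ _ _ X -> _](_ : _ = hess_ext1 x v w)//.
by rewrite /hess_ext1 (edotC v w); field.
Unshelve. all: end_near. Qed.

End sphere_C2_calculus.

Section linear_trace.
Context (R : realType) (m : nat).
Implicit Types v w x : 'rV[R]_m.
Local Notation e i := (delta_mx (0 : 'I_1) i).

Lemma linear_form0 (l : 'rV[R]_m -> R) :
  (forall a v w, l (a *: v + w) = a * l v + l w) -> l 0 = 0.
Proof. by move=> lP; have := lP 1 0 0; rewrite scale1r addr0 mul1r; lra. Qed.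

Lemma linear_formZ (l : 'rV[R]_m -> R) c v :
  (forall a v w, l (a *: v + w) = a * l v + l w) -> l (c *: v) = c * l v.
Proof. by move=> lP; rewrite -[c *: v]addr0 lP linear_form0// addr0. Qed.

Lemma linear_sum_coord (l : 'rV[R]_m -> R) v :
  (forall a v w, l (a *: v + w) = a * l v + l w) ->
  l v = \sum_(i < m) v 0 i * l (e i).
Proof.
move=> lP; rewrite {1}[v]row_sum_delta.
elim/big_rec2: _ => [|i a b _ <-]; first exact: linear_form0.
exact: lP.
Qed.

(* For c = 1 and c = 2 (and a unit vector x) the vectors
   e_i - c <x, e_i> x are the projections, resp. the reflections, of the
   standard basis with respect to the hyperplane orthogonal to x. *)
Lemma bilinear_trace_shift (B : 'rV[R]_m -> 'rV[R]_m -> R) x c :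
  (forall a v w z, B (a *: v + w) z = a * B v z + B w z) ->
  (forall a v w z, B z (a *: v + w) = a * B z v + B z w) ->
  \sum_(i < m) B (e i - (c * edot x (e i)) *: x) (e i - (c * edot x (e i)) *: x)
  = \sum_(i < m) B (e i) (e i) + (c ^+ 2 * edot x x - 2 * c) * B x x.
Proof.
move=> Bl Br.
have Bli := linear_sum_coord x (fun a v w => Bl a v w x).
have Bri := linear_sum_coord x (fun a v w => Br a v w x).
(* The two cross terms are separated so that one [B x x] is expanded in its first argument and the
   other in its second. *)
rewrite (_ : (c ^+ 2 * edot x x - 2 * c) * B x x = c ^+ 2 * B x x * edot x x
  + (- c) * B x x + (- c) * B x x); last by ring.
rewrite {3}Bli {2}Bri [edot x x]/edot !mulr_sumr -!big_split/=.
by apply: eq_bigr => i _; rewrite edot_deltar [e i - _]addrC -scaleNr Bl !Br; ring.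
Qed.

End linear_trace.

(** * The covariant Hessian in terms of ambient derivatives *)

Section sphere_hessian.
Context (R : realType) (n : nat) (u : 'rV[R]_n.+1 -> R).
Hypothesis u_C2 : sphere_C2 u.
Implicit Types x y v w xi eta : 'rV[R]_n.+1.
Local Notation U0 := (homog_ext 0 u).
Local Notation U := (homog_ext 1 u).
Local Notation e i := (delta_mx (0 : 'I_1) i).

(** The Euclidean gradient of [U0] is orthogonal to the radius, so the tangential projection leaves
    it unchanged; its degree -1 gives the factor [enorm y]. *)
Let grad0_radial y : y != 0 ->
  sphere_grad u (radial_proj y) = \row_i (enorm y * 'D_(e i) U0 y).
Proof.
move=> y0; have r0 : 0 < (enorm y)^-1 by rewrite invr_gt0 enorm_gt0.
have ry0 : radial_proj y != 0.
  by apply: unit_sphere_neq0; exact: enorm_radial.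
rewrite /sphere_grad /tangent_proj (_ : edot _ _ = 0) ?scale0r ?subr0.
  by apply/rowP => i; rewrite !mxE derive_ext0Z// invrK.
rewrite -[RHS](derive_ext0_radial u ry0) /edot.
rewrite [RHS](linear_sum_coord (l := fun v => 'D_v U0 (radial_proj y))).
  by apply: eq_bigr => i _; rewrite [X in _ * X]mxE.
by move=> a v w; exact: derive_ext0_linear.
Qed.

(** Along the tangent vector [xi] the derivative of the norm in the extended gradient field
    vanishes, and pairing with the tangent vector [eta] absorbs the final projection. *)
Lemma sphere_hessE x xi eta : unit_sphere x -> edot x xi = 0 ->
  edot x eta = 0 -> sphere_hess u x xi eta = 'D_xi ('D_eta U0) x.
Proof.
move=> x1 xxi xeta; have x0 := unit_sphere_neq0 x1.
pose W y : 'rV[R]_n.+1 := \row_i (enorm y * 'D_(e i) U0 y).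
have dW i : is_derive x xi (fun y => enorm y * 'D_(e i) U0 y)
    ('D_xi ('D_(e i) U0) x).
  have := is_derive_mul (is_derive_enorm xi x0) (is_derive2_ext0 u_C2 (e i) xi x0).
  by rewrite xxi mul0r mulr0 addr0 [enorm x]x1 mul1r.
have derW : derivable W x xi.
  apply/derivable_mxP => i j; rewrite (_ : (fun y => _) =
    (fun y => enorm y * 'D_(e j) U0 y)); first exact: ex_derive.
  by apply/funext => y; rewrite mxE.
have -> : sphere_hess u x xi eta = edot ('D_xi W x) eta.
  rewrite /sphere_hess /sphere_covD.
  rewrite (_ : 'D_xi (sphere_grad u \o _) x = 'D_xi W x).
    by rewrite /tangent_proj edotBl edotZl xeta mulr0 subr0.
  apply: near_eq_derive; near=> y.
  by rewrite /= grad0_radial//; near: y; exact: near_neq0.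
rewrite [RHS](linear_sum_coord (l := fun v => 'D_xi ('D_v U0) x)).
  apply: eq_bigr => i _; rewrite derive_mx// mxE mulrC; congr (_ * _).
  rewrite -[RHS](@derive_val _ _ _ _ _ _ _ (dW i)); congr ('D_xi _ x).
  by apply/funext => y; rewrite mxE.
by move=> a v w; exact: derive2_ext0_linearl.
Unshelve. all: end_near. Qed.

(** Case [c = 1] of [bilinear_trace_shift]; the correction is a multiple of the second radial
    derivative of [U0], which is 0. *)
Lemma laplace_beltramiE x : unit_sphere x ->
  laplace_beltrami u x = \sum_(i < n.+1) 'D_(e i) ('D_(e i) U0) x.
Proof.
move=> x1; have x0 := unit_sphere_neq0 x1.
have tan v : edot x (tangent_proj x v) = 0.
  by rewrite /tangent_proj edotBr edotZr unit_sphere_edot// mulr1 subrr.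
rewrite /laplace_beltrami; under eq_bigr do rewrite sphere_hessE//.
rewrite /tangent_proj.
have := @bilinear_trace_shift R n.+1 (fun v w => 'D_w ('D_v U0) x) x 1.
move=> /(_ (fun a v w z => derive2_ext0_linearl u_C2 a v w z x0)).
move=> /(_ (fun a v w z => derive2_ext0_linearr u_C2 a v w z x0)) /=.
have D0 := derive2_ext0_radial u_C2 x0.
move=> E; have {}E := etrans E (congr1 (fun t => _ + _ * t) D0).
rewrite mulr0 addr0 in E; apply: etrans E.
by apply: eq_bigr => i _; rewrite mul1r.
Qed.

Local Notation H := (hess_ext1 u).

Lemma hess_ext1_linearl x a v w z : x != 0 ->
  H x (a *: v + w) z = a * H x v z + H x w z.
Proof.
move=> x0; have := derive_ext0_linear u_C2 a v w x0.
have := derive2_ext0_linearl u_C2 a v w z x0.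
rewrite /hess_ext1 !edotE.
generalize ('D_z ('D_(a *: v + w) U0) x) ('D_(a *: v + w) U0 x) ('D_z ('D_v U0) x)
  ('D_z ('D_w U0) x) ('D_v U0 x) ('D_w U0 x) ('D_z U0 x) => D1 D2 ? ? ? ? ? -> ->.
ring.
Qed.

Lemma hess_ext1_linearr x a v w z : x != 0 ->
  H x z (a *: v + w) = a * H x z v + H x z w.
Proof.
move=> x0; have := derive_ext0_linear u_C2 a v w x0.
have := derive2_ext0_linearr u_C2 a v w z x0.
rewrite /hess_ext1 !edotE.
generalize ('D_(a *: v + w) ('D_z U0) x) ('D_(a *: v + w) U0 x) ('D_v ('D_z U0) x)
  ('D_w ('D_z U0) x) ('D_v U0 x) ('D_w U0 x) ('D_z U0 x) => D1 D2 ? ? ? ? ? -> ->.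
ring.
Qed.

Lemma hess_ext1_tangent x xi : unit_sphere x -> edot x xi = 0 ->
  H x xi xi = sphere_hess u x xi xi + u x * edot xi xi.
Proof.
move=> x1 xxi; rewrite sphere_hessE// /hess_ext1 xxi x1.
have -> : U0 x = u x.
  by rewrite /homog_ext expr0z mul1r /radial_proj x1 invr1 scale1r.
generalize ('D_xi ('D_xi U0) x) ('D_xi U0 x) => D1 D2.
by rewrite !mul0r !mul1r subr0 divr1; ring.
Qed.

(** The first-order terms sum to a multiple of the radial derivative of [U0], which is 0. The
    zeroth-order coefficient is [n.+1 - 1] over the norm. What remains is the equation at the radial
    projection of [x], rescaled by homogeneity. *)
Lemma trace_hess_ext1 (f : 'rV[R]_n.+1 -> R) x : x != 0 ->
  (forall x, unit_sphere x -> laplace_beltrami u x + n%:R * u x = f x) ->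
  \sum_(i < n.+1) H x (e i) (e i) = homog_ext (-1) f x.
Proof.
move=> x0 u_sol; have r0 := enorm_gt0 x0.
have rx1 := enorm_radial x0; have rx0 := unit_sphere_neq0 rx1.
pose S := \sum_(i < n.+1) 'D_(e i) ('D_(e i) U0) x.
have S1 : laplace_beltrami u (radial_proj x) = enorm x ^+ 2 * S.
  rewrite laplace_beltramiE// mulr_sumr; apply: eq_bigr => i _.
  by rewrite derive2_ext0Z// ?invr_gt0// exprVn invrK.
have radial : \sum_(i < n.+1) x 0 i * 'D_(e i) U0 x = 0.
  rewrite -[RHS](derive_ext0_radial u x0).
  rewrite [RHS](linear_sum_coord (l := fun v => 'D_v U0 x))// => a v w.
  exact: derive_ext0_linear.
have -> : \sum_(i < n.+1) H x (e i) (e i) =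
    n%:R / enorm x * U0 x + enorm x * S.
  under eq_bigr do rewrite /hess_ext1 !edot_deltar.
  rewrite !big_split/= -mulr_suml sumrB.
  have -> : \sum_(i < n.+1) x 0 i / enorm x * 'D_(e i) U0 x = 0.
    by under eq_bigr do rewrite mulrAC; rewrite -mulr_suml radial mul0r.
  rewrite -!mulr_suml -/(edot x x) -sqr_enorm -mulr_sumr !addr0.
  congr (_ * _ + _).
  under eq_bigr do rewrite mxE !eqxx.
  rewrite sumr_const card_ord -[1 *+ n.+1]natr1; field.
  exact: lt0r_neq0.
have := u_sol _ rx1; rewrite S1 /homog_ext exprN1 expr0z mul1r => <-.
by field; exact: lt0r_neq0.
Qed.

End sphere_hessian.

(** * The minimum principle in a half space *)

Section second_derivative_test.
Context (R : realType).

Lemma is_derive_cvg (f : R -> R) (x d : R) : is_derive x 1 f d ->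
  h^-1 * (f (x + h) - f x) @[h --> 0^'] --> d.
Proof.
move=> [df <-]; have := df; rewrite /derivable /derive.
rewrite (_ : (fun h => _) = (fun h => h^-1 * (f (x + h) - f x)))//.
by apply/funext => h /=; rewrite [h *: 1]mulr1 (addrC h).
Qed.

(** The minimum gives [f1 0 = 0]. If [d < 0], then [f1] is negative just to the right of 0, and the
    mean value theorem produces a value below [f 0]. *)
Lemma local_min_derive2_ge0_1d (f f1 : R -> R) (e d : R) : 0 < e ->
  (forall s : R, `|s| < e -> is_derive s 1 f (f1 s)) ->
  is_derive (0 : R) (1 : R) f1 d ->
  (forall s, `|s| < e -> f 0 <= f s) -> 0 <= d.
Proof.
move=> e0 df df1 fmin; rewrite leNgt; apply/negP => d0.
have inI s : s \in `]- e, e[ -> `|s| < e by rewrite in_itv/= ltr_norml.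
have f10 : f1 0 = 0.
  have I0 : 0 \in `]- e, e[ by rewrite in_itv/= oppr_lt0 e0.
  have eNe : - e <= e by rewrite ge0_cp// ltW.
  have [||_ D0] := @derive1_at_min _ f _ _ 0 eNe _ I0.
  - by move=> t /inI/df/@ex_derive.
  - by move=> t /inI/fmin.
  by have := df 0; rewrite normr0 => /(_ e0) [_ <-].
have : \forall h \near 0^', h^-1 * (f1 (0 + h) - f1 0) < 0.
  exact: cvgr_lt (is_derive_cvg df1) _ d0.
rewrite f10 => -[r /= r0 rf1].
pose s := Num.min (e / 2) (r / 2).
have s0 : 0 < s by rewrite lt_min !divr_gt0.
have se : s < e by rewrite gt_min ltr_pdivrMr// ltr_pMr// ltr1n.
have sr : s < r by rewrite gt_min orbC ltr_pdivrMr// ltr_pMr// ltr1n.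
have f1neg c : 0 < c -> c <= s -> f1 c < 0.
  move=> c0 cs; have := rf1 c.
  rewrite /ball_/= sub0r normrN gtr0_norm// add0r subr0.
  move=> /(_ (le_lt_trans cs sr) (lt0r_neq0 c0)).
  by rewrite pmulr_rlt0// invr_gt0.
have [||c] := @MVT _ f f1 0 s s0.
- move=> c; rewrite in_itv/= => /andP[c0 cs].
  by apply: df; rewrite gtr0_norm// (lt_trans cs).
- apply: derivable_within_continuous => c; rewrite in_itv/= => /andP[c0 cs].
  have : `|c| < e by rewrite ger0_norm// (le_lt_trans cs).
  by move=> /df/@ex_derive.
rewrite in_itv/= subr0 => /andP[c0 cs] E.
have := fmin s; rewrite gtr0_norm// => /(_ se).
by rewrite -subr_ge0 E leNgt pmulr_llt0// f1neg// ltW.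
Qed.

Lemma local_min_derive2_ge0 (V : normedModType R) (f f1 : V -> R) (x w : V) (d : R) :
  (\forall y \near x, is_derive y w f (f1 y)) -> is_derive x w f1 d ->
  (\forall y \near x, f x <= f y) -> 0 <= d.
Proof.
move=> df /is_derive_at df1 fmin.
have : \forall s \near (0 : R), is_derive (x + s *: w) w f (f1 (x + s *: w))
    /\ f x <= f (x + s *: w).
  have cl : x + s *: w @[s --> (0 : R)] --> x.
    rewrite -[X in _ --> X]addr0 -(scale0r w).
    by apply: cvgD; [exact: cvg_cst|apply: cvgZr_tmp; exact: cvg_id].
  by apply: filterI; [exact: (cl _ df)|exact: (cl _ fmin)].
move=> [r /= r0 rf].
apply: (@local_min_derive2_ge0_1d (fun s => f (x + s *: w))
  (fun s => f1 (x + s *: w)) r) => // s sr.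
- by apply/is_derive_line; apply: (rf s _).1; rewrite /ball_ /= sub0r normrN.
- by rewrite scale0r addr0; apply: (rf s _).2; rewrite /ball_ /= sub0r normrN.
Qed.

End second_derivative_test.

Lemma is_derive_translate (R : realType) (V : normedModType R) (f : V -> R)
    (a x v : V) (d : R) :
  is_derive (x + a) v f d -> is_derive x v (fun y => f (y + a)) d.
Proof.
move=> /is_derive_at fd; apply/is_derive_at.
rewrite (_ : (fun s : R => _) = (fun s : R => f (x + a + s *: v)))//.
by apply/funext => s; rewrite addrAC.
Qed.

(** * The barrier function and its derivatives *)

Section barrier.
Context (R : realType) (n : nat) (xi : 'rV[R]_n.+1).
Implicit Types y w : 'rV[R]_n.+1.
Local Notation e i := (delta_mx (0 : 'I_1) i).

(* Homogeneous of degree 0 and superharmonic above the hyperplane orthogonal to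
   xi, see trace_height2. *)
Definition height y := edot y xi * (enorm y)^-1.

Definition height1 w y :=
  edot w xi * (enorm y)^-1 - edot y xi * (edot y w * (enorm y) ^- 3).

Definition height2 w y :=
  (3 * edot y xi * edot y w ^+ 2 / enorm y ^+ 5
   - 2 * (edot w xi * edot y w) / enorm y ^+ 3) - edot y xi * edot w w / enorm y ^+ 3.

Lemma is_derive_height y w : y != 0 -> is_derive y w height (height1 w y).
Proof.
move=> y0; have r0 : enorm y != 0 by rewrite gt_eqF ?enorm_gt0.
have := is_derive_mul (is_derive_edot xi y w)
  (is_derive_inv r0 (is_derive_enorm w y0)).
rewrite [X in is_derive _ _ _ X -> _](_ : _ = height1 w y)//.
by rewrite /height1; field.
Qed.

Lemma is_derive_height1 y w : y != 0 ->
  is_derive y w (height1 w) (height2 w y).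
Proof.
move=> y0; have r0 : enorm y != 0 by rewrite gt_eqF ?enorm_gt0.
have dr := is_derive_enorm w y0.
have r30 : enorm y * (enorm y * enorm y) != 0 by rewrite !mulf_neq0.
rewrite (_ : height1 w = fun y => edot w xi * (enorm y)^-1 -
    edot y xi * (edot y w * (enorm y * (enorm y * enorm y))^-1)); last first.
  by apply/funext => z; rewrite /height1 !exprS expr0 mulr1.
have := is_derive_sub (is_derive_mulC (edot w xi) (is_derive_inv r0 dr))
  (is_derive_mul (is_derive_edot xi y w) (is_derive_mul (is_derive_edot w y w)
     (is_derive_inv (f := fun y => enorm y * (enorm y * enorm y)) r30
        (is_derive_mul dr (is_derive_mul dr dr))))).
rewrite [X in is_derive _ _ _ X -> _](_ : _ = height2 w y)//.
by rewrite /height2; field.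
Qed.

(** The three sums contribute [3], [- 2] and [- n.+1] times [edot y xi / enorm y ^+ 3]. For positive
    [n] the trace is strictly negative above the hyperplane, which leaves room for a small quadratic
    perturbation. *)
Lemma trace_height2 y : y != 0 ->
  \sum_(i < n.+1) height2 (e i) y = - (n%:R * edot y xi / enorm y ^+ 3).
Proof.
move=> y0; have r0 : enorm y != 0 by rewrite gt_eqF ?enorm_gt0.
rewrite /height2 !sumrB -!mulr_suml -!mulr_sumr.
have -> : \sum_(i < n.+1) edot y (e i) ^+ 2 = enorm y ^+ 2.
  by rewrite sqr_enorm; apply: eq_bigr => i _; rewrite edot_deltar expr2.
have -> : \sum_(i < n.+1) edot (e i) xi * edot y (e i) = edot y xi.
  by apply: eq_bigr => i _; rewrite (edotC (e i)) !edot_deltar mulrC.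
have -> : \sum_(i < n.+1) edot (e i : 'rV[R]_n.+1) (e i) = n.+1%:R.
  rewrite -[RHS]mulr1 mulr_natl -[in RHS](card_ord n.+1) -sumr_const.
  by apply: eq_bigr => i _; rewrite edot_deltar mxE !eqxx.
by rewrite -natr1; field.
Qed.

End barrier.

Lemma derive_bound_lipschitz (R : realType) (f df : R -> R) (M h c : R) :
  (forall s : R, `|s| <= h -> is_derive s 1 f (df s)) ->
  (forall s, `|s| <= h -> `|df s| <= M) -> `|c| <= h ->
  `|f c - f 0| <= M * `|c|.
Proof.
move=> fdf dfM ch.
have ab (a b : R) : `|a| <= h -> `|b| <= h -> a < b -> `|f b - f a| <= M * (b - a).
  move=> ah bh ab; have inh s : a <= s <= b -> `|s| <= h.
    move=> /andP[as_ sb]; move: ah bh; rewrite !ler_norml; lra.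
  have [||s] := @MVT _ f df a b ab.
  - by move=> s; rewrite in_itv/= => /andP[/ltW as_ /ltW sb];
      apply/fdf/inh; rewrite as_.
  - by apply: derivable_within_continuous => s; rewrite in_itv/= => /inh/fdf/@ex_derive.
  rewrite in_itv/= => /andP[/ltW as_ /ltW sb] ->.
  rewrite normrM (@gtr0_norm _ (b - a)) ?subr_gt0// ler_wpM2r ?subr_ge0 ?(ltW ab)//.
  by apply/dfM/inh; rewrite as_.
have h0 : `|0 : R| <= h by rewrite normr0 (le_trans _ ch).
have [c0|c0|->] := ltgtP c 0.
- by rewrite distrC (le_trans (ab _ _ ch h0 c0))// ltr0_norm// sub0r.
- by rewrite (le_trans (ab _ _ h0 ch c0))// gtr0_norm// subr0.
- by rewrite subrr !normr0 mulr0.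
Qed.

Section pointwise_continuous.
Context (R : realType) (T : topologicalType).
Implicit Types (f g : T -> R) (x : T).

Lemma continuous_add f g x : {for x, continuous f} -> {for x, continuous g} ->
  {for x, continuous (fun y => f y + g y)}.
Proof. by move=> fx gx; exact: (continuousD (f := f) (g := g)). Qed.

Lemma continuous_sub f g x : {for x, continuous f} -> {for x, continuous g} ->
  {for x, continuous (fun y => f y - g y)}.
Proof. by move=> fx gx; exact: (continuousB (f := f) (g := g)). Qed.

Lemma continuous_mul f g x : {for x, continuous f} -> {for x, continuous g} ->
  {for x, continuous (fun y => f y * g y)}.
Proof. by move=> fx gx; exact: (continuousM (s := f) (t := g)). Qed.

Lemma continuous_mulC c f x : {for x, continuous f} ->
  {for x, continuous (fun y => c * f y)}.
Proof. by apply: continuous_mul; exact: cst_continuous. Qed.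

End pointwise_continuous.

(** * Minimum principle for the derivative of [Psi] along [xi], [E] being the Laplacian of [Psi] *)

Section minimum_principle.
Context (R : realType) (n : nat) (Psi E : 'rV[R]_n.+1 -> R).
Context (Psi1 : 'rV[R]_n.+1 -> 'rV[R]_n.+1 -> R).
Context (Psi2 : 'rV[R]_n.+1 -> 'rV[R]_n.+1 -> 'rV[R]_n.+1 -> R).
Context (xi : 'rV[R]_n.+1).
Local Notation e i := (delta_mx (0 : 'I_1) i).
Implicit Types (y z v w : 'rV[R]_n.+1) (a b c h s : R).
Hypothesis n_gt0 : (0 < n)%N.
Hypothesis xi1 : unit_sphere xi.
Hypothesis dPsi : forall y v, y != 0 -> is_derive y v Psi (Psi1 v y).
Hypothesis dPsi1 : forall y v w, y != 0 -> is_derive y w (Psi1 v) (Psi2 v w y).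
Hypothesis Psi_cont : forall y, y != 0 -> {for y, continuous Psi}.
Hypothesis Psi1_cont : forall y, y != 0 -> {for y, continuous (Psi1 xi)}.
Hypothesis Psi2_cont : forall y, y != 0 -> {for y, continuous (Psi2 xi xi)}.
Hypothesis trace_Psi2 : forall y, y != 0 -> \sum_(i < n.+1) Psi2 (e i) (e i) y = E y.
Hypothesis Psi1_homog : forall c y, 0 < c -> y != 0 -> Psi1 xi (c *: y) = Psi1 xi y.
Hypothesis Psi1_bound : forall y, y != 0 -> edot y xi = 0 -> Psi1 xi y = 0.
Hypothesis E_mono : forall z a b, edot xi z = 0 -> 0 < a -> a <= b ->
  E (z + b *: xi) <= E (z + a *: xi).

Let hemisphere := [set y : 'rV[R]_n.+1 | enorm y = 1 /\ 0 <= edot y xi].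

Let hemisphere_compact : compact hemisphere.
Proof.
apply: bounded_closed_compact.
  exists 1; split; first exact: num_real.
  move=> M M1 y [y1 _] /=; apply: le_trans (normr_le_enorm y) _.
  by rewrite y1 ltW.
have -> : hemisphere = (@enorm R n.+1 @^-1` [set 1]) `&`
    ((fun y => edot y xi) @^-1` [set t | 0 <= t]) by [].
apply: closedI; apply: closed_comp.
- by move=> y _; exact: continuous_enorm.
- exact: closed_eq.
- by move=> y _; exact: continuous_edot.
- exact: closed_ge.
Qed.

Let height_cont y : y != 0 -> {for y, continuous (height xi)}.
Proof.
move=> y0; apply: continuous_mul; first exact: continuous_edot.
by apply: continuousV; [rewrite gt_eqF ?enorm_gt0|exact: continuous_enorm].
Qed.

Let heightZ c y : 0 < c -> y != 0 -> height xi (c *: y) = height xi y.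
Proof.
move=> c0 y0; have := enorm_gt0 y0 => r0.
by rewrite /height edotZl enormZ gtr0_norm//; field; rewrite !gt_eqF.
Qed.

(** Both terms are homogeneous of degree 0, so a minimum over the compact closed hemisphere bounds
    the values on the whole open half space. *)
Let hemisphere_min (eps : R) : exists2 y0, hemisphere y0 &
  forall y, 0 < edot y xi ->
    Psi1 xi y0 + eps * height xi y0 <= Psi1 xi y + eps * height xi y.
Proof.
have [|||y0 y0A ymin] :=
  @EVT_min_rV R n.+1 (fun y => Psi1 xi y + eps * height xi y) hemisphere.
- exists xi; split=> //; rewrite unit_sphere_edot//.
- exact: hemisphere_compact.
- apply: continuous_in_subspaceT => y /set_mem [y1 _].
  have y0 : y != 0 by exact: unit_sphere_neq0.
  suff : {for y, continuous (fun y => Psi1 xi y + eps * height xi y)} by [].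
  by apply: continuous_add; [exact: Psi1_cont|apply: continuous_mulC; exact: height_cont].
exists y0; first exact/set_mem.
move=> y ty; have y0' : y != 0.
  by apply: contraTneq ty => ->; rewrite edot0l ltxx.
have r0 : 0 < (enorm y)^-1 by rewrite invr_gt0 enorm_gt0.
have := ymin (radial_proj y); rewrite /radial_proj Psi1_homog// heightZ//; apply.
apply/mem_set; split; first exact: enorm_radial.
by rewrite edotZl mulr_ge0// ltW.
Qed.


(** The backward shift is written [(- h) *: xi] so that facts about [y + s *: xi] with [|s| <= h]
    serve both ends. *)
Let quotient (h : R) y := (2 * h)^-1 * (Psi (y + h *: xi) - Psi (y + (- h) *: xi)).

(** By the mean value theorem the quotient is [Psi1 xi] at some [y + c *: xi] with [|c| < h]; the
    bound on [Psi2 xi xi] along the segment controls the shift back to [y]. *)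
Let quotient_approx (h M : R) y : 0 < h ->
  (forall s, `|s| <= h -> y + s *: xi != 0 /\ `|Psi2 xi xi (y + s *: xi)| <= M) ->
  `|quotient h y - Psi1 xi y| <= M * h.
Proof.
move=> h0 hM.
have dp s : `|s| <= h -> is_derive s 1 (fun s : R => Psi (y + s *: xi)) (Psi1 xi (y + s *: xi)).
  by move=> /hM[ys0 _]; apply/is_derive_line; exact: dPsi.
have dp1 s : `|s| <= h -> is_derive s 1 (fun s : R => Psi1 xi (y + s *: xi))
    (Psi2 xi xi (y + s *: xi)).
  by move=> /hM[ys0 _]; apply/is_derive_line; exact: dPsi1.
have hh : - h < h by lra.
have [||c] := @MVT _ (fun s : R => Psi (y + s *: xi))
    (fun s : R => Psi1 xi (y + s *: xi)) _ _ hh.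
- move=> s; rewrite in_itv/= => /andP[/ltW h1 /ltW h2].
  by apply: dp; rewrite ler_norml h1.
- apply: derivable_within_continuous => s; rewrite in_itv/= -ler_norml.
  by move=> /dp/@ex_derive.
rewrite in_itv/= -ltr_norml => ch E1.
have -> : quotient h y = Psi1 xi (y + c *: xi).
  by rewrite /quotient E1; field; rewrite gt_eqF.
have := derive_bound_lipschitz dp1 (fun s sh => (hM s sh).2) (ltW ch).
rewrite scale0r addr0 => /le_trans; apply.
have M0 : 0 <= M.
  by apply: le_trans (normr_ge0 _) (hM 0 _).2; rewrite normr0 ltW.
by rewrite ler_wpM2l// ltW.
Qed.


Let dquotient h y w : y + h *: xi != 0 -> y + (- h) *: xi != 0 ->
  is_derive y w (quotient h)
    ((2 * h)^-1 * (Psi1 w (y + h *: xi) - Psi1 w (y + (- h) *: xi))).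
Proof.
move=> y1 y2; apply: is_derive_mulC.
by apply: is_derive_sub; apply: is_derive_translate; exact: dPsi.
Qed.

Let d2quotient h y v w : y + h *: xi != 0 -> y + (- h) *: xi != 0 ->
  is_derive y w
    (fun y => (2 * h)^-1 * (Psi1 v (y + h *: xi) - Psi1 v (y + (- h) *: xi)))
    ((2 * h)^-1 * (Psi2 v w (y + h *: xi) - Psi2 v w (y + (- h) *: xi))).
Proof.
move=> y1 y2; apply: is_derive_mulC.
by apply: is_derive_sub; apply: is_derive_translate; exact: dPsi1.
Qed.

Let quotient_cont h y : y + h *: xi != 0 -> y + (- h) *: xi != 0 ->
  {for y, continuous (quotient h)}.
Proof.
move=> y1 y2; apply: continuous_mulC.
have trans (a : 'rV[R]_n.+1) : {for y, continuous (fun y : 'rV[R]_n.+1 => y + a)}.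
  by apply: (@cvgD _ _ _ (nbhs y)); [exact: cvg_id|exact: cvg_cst].
by apply: continuous_sub;
  apply: (continuous_comp (trans _)); exact: Psi_cont.
Qed.

(** Both shifted points lie over the same foot [z] in the hyperplane, the lower one at positive
    height, so [E_mono] compares them. *)
Let trace_quotient_le0 h y : 0 < h -> 0 < edot (y + (- h) *: xi) xi ->
  \sum_(i < n.+1) ((2 * h)^-1 *
    (Psi2 (e i) (e i) (y + h *: xi) - Psi2 (e i) (e i) (y + (- h) *: xi))) <= 0.
Proof.
move=> h0 th.
have tE s : edot (y + s *: xi) xi = edot y xi + s.
  by rewrite edotDl edotZl unit_sphere_edot// mulr1.
have nz s : - h <= s -> y + s *: xi != 0.
  move=> hs; apply: contraTneq th => /(congr1 (fun z => edot z xi)).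
  by rewrite !tE edot0l => ?; rewrite -leNgt; lra.
rewrite -mulr_sumr sumrB !trace_Psi2 ?nz//; last by lra.
rewrite pmulr_rle0 ?invr_gt0 ?mulr_gt0// subr_le0.
pose z := y - edot y xi *: xi.
have zE s : y + s *: xi = z + (edot y xi + s) *: xi.
  by rewrite /z scalerDl addrA subrK.
rewrite !zE; apply: E_mono; last by lra.
  by rewrite edotC /z edotBl edotZl unit_sphere_edot// mulr1 subrr.
by rewrite -tE.
Qed.

(** The trace of the barrier is strictly negative at [y0], hence still so after adding a small
    quadratic term, and near [y0] by continuity. *)
Let barrier_neg eps y0 : 0 < eps -> unit_sphere y0 -> 0 < edot y0 xi ->
  exists2 eta, 0 < eta & \forall y \near y0,
    \sum_(i < n.+1) (eps * height2 xi (e i) y + eta * (2 * edot (e i) (e i))) < 0.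
Proof.
move=> eps0 y01 t0; have y00 := unit_sphere_neq0 y01.
pose k y := eps * - (n%:R * (edot y xi * (enorm y * (enorm y * enorm y))^-1)).
(* With this [eta] the quadratic term contributes half the absolute value of [k y0]. *)
pose eta := eps * edot y0 xi * n%:R / (4 * n.+1%:R).
have n0 : 0 < n%:R :> R by rewrite ltr0n.
exists eta.
  by rewrite /eta divr_gt0 ?mulr_gt0 ?ltr0n.
have kneg : k y0 + eta * (2 * n.+1%:R) < 0.
  rewrite /k y01 !mulr1 invr1 mulr1.
  have -> : eta * (2 * n.+1%:R) = eps * edot y0 xi * n%:R / 2.
    have := lt0r_neq0 (ltr0Sn R n); rewrite /eta.
    by generalize (n.+1%:R : R) => N N0; field.
  have : 0 < eps * edot y0 xi * n%:R by rewrite !mulr_gt0.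
  by rewrite mulrN mulrCA mulrA; lra.
have kc : {for y0, continuous (fun y => k y + eta * (2 * n.+1%:R))}.
  apply: continuous_add; last exact: cst_continuous.
  apply: continuous_mulC; apply: continuousN; apply: continuous_mulC.
  apply: continuous_mul; first exact: continuous_edot.
  apply: continuousV; first by rewrite y01 !mulr1 oner_neq0.
  by do ![apply: continuous_mul]; exact: continuous_enorm.
have : \forall y \near y0, k y + eta * (2 * n.+1%:R) < 0.
  exact: (cvgr_lt _ kc _ kneg).
move=> kn; near=> y.
rewrite big_split/= -!mulr_sumr trace_height2; last first.
  by near: y; exact: near_neq0.
have -> : \sum_(i < n.+1) edot (e i : 'rV[R]_n.+1) (e i) = n.+1%:R.
  rewrite -[RHS]mulr1 mulr_natl -[in RHS](card_ord n.+1) -sumr_const.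
  by apply: eq_bigr => i _; rewrite edot_deltar mxE !eqxx.
rewrite !exprS expr0 mulr1 -mulrA -/(k y).
by near: y; exact: kn.
Unshelve. all: end_near. Qed.


Let barrier_derive eta y0 y w :
  is_derive y w (fun y => eta * (edot y y - 2 * edot y y0)) (eta * (2 * edot w (y - y0))).
Proof.
rewrite (_ : 2 * edot w (y - y0) = 2 * edot y w - 2 * edot w y0); last first.
  by rewrite edotBr (edotC w y); ring.
apply: is_derive_mulC; apply: is_derive_sub; first exact: is_derive_edot_diag.
by apply: is_derive_mulC; exact: is_derive_edot.
Qed.

Let barrier_derive2 eta y0 y v w :
  is_derive y w (fun y => eta * (2 * edot v (y - y0))) (eta * (2 * edot v w)).
Proof.
do 2![apply: is_derive_mulC].
rewrite (_ : (fun y => _) = (fun y => edot y v - edot y0 v)); last first.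
  by apply/funext => z; rewrite edotBr !(edotC v).
rewrite -[edot v w]subr0 (edotC v).
by apply: is_derive_sub; exact: is_derive_edot.
Qed.

(** A negative value would give [Psi1 xi + eps * height xi] a negative minimum over the hemisphere,
    at a point [y0] off the hyperplane. Replacing [Psi1 xi] by a difference quotient and adding a
    quadratic term yields a twice differentiable function with an interior minimum near [y0] and a
    negative trace of second derivatives, a contradiction. *)
Lemma minimum_principle y : 0 < edot y xi -> 0 <= Psi1 xi y.
Proof.
move=> ty; rewrite leNgt; apply/negP => Vy.
have y_neq0 z : 0 < edot z xi -> z != 0.
  by apply: contraTneq => ->; rewrite edot0l ltxx.
have gy : 0 < height xi y by rewrite mulr_gt0// invr_gt0 enorm_gt0// y_neq0.
(* With this [eps] the barrier cancels half of the negative value at [y]. *)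
pose eps := - Psi1 xi y / (2 * height xi y).
have eps0 : 0 < eps.
  by apply: divr_gt0; [rewrite oppr_gt0|rewrite mulr_gt0].
have [y0 [y01 t0_ge0] y0min] := hemisphere_min eps.
have y00 := unit_sphere_neq0 y01.
pose W z := Psi1 xi z + eps * height xi z.
have Wy0 : W y0 < 0.
  apply: le_lt_trans (y0min _ ty) _.
  have -> : eps * height xi y = - Psi1 xi y / 2.
    by rewrite /eps; field; rewrite gt_eqF.
  by move: Vy; lra.
(* On the hyperplane both [Psi1 xi] and the height vanish, so [W] is not negative there. *)
have t0 : 0 < edot y0 xi.
  rewrite lt_neqAle t0_ge0 andbT; apply/eqP => /esym t00.
  by move: Wy0; rewrite /W Psi1_bound// /height t00 mul0r mulr0 addr0 ltxx.
have [eta eta0 barrier] := barrier_neg eps0 y01 t0.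
pose M := `|Psi2 xi xi y0| + 1.
have M0 : 0 < M by rewrite ltr_wpDl.
have : \forall z \near y0, [/\ 0 < edot z xi, `|Psi2 xi xi z| <= M &
    \sum_(i < n.+1) (eps * height2 xi (e i) z + eta * (2 * edot (e i) (e i))) < 0].
  near=> z; split; near: z; last exact: barrier.
  - exact: (cvgr_gt _ (@continuous_edot _ _ xi y0)).
  - by apply: (cvgr_norm_le _ (Psi2_cont y00)); rewrite /M ltrDl.
move=> /nbhs_normP[r /= r0 ball_r].
(* A point within [rho] of [y0], shifted along [xi] by at most [h <= rho], stays within
   [2 * rho < r] of [y0]. *)
pose rho := r / 3.
have rho0 : 0 < rho by rewrite divr_gt0.
(* The second bound keeps the approximation errors at the centre and at a boundary point, [M * h]
   each, together below [eta * rho ^+ 2]. *)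
pose h := Num.min rho (eta * rho ^+ 2 / (4 * M)).
have h0 : 0 < h by rewrite lt_min rho0 divr_gt0 ?mulr_gt0 ?exprn_gt0.
have hrho : h <= rho by rewrite ge_min lexx.
have Mh : 2 * (M * h) < eta * rho ^+ 2.
  have : h <= eta * rho ^+ 2 / (4 * M) by rewrite ge_min lexx orbT.
  rewrite ler_pdivlMr ?mulr_gt0// => ?.
  have : 0 < M * h by rewrite mulr_gt0.
  lra.
pose B := [set z : 'rV[R]_n.+1 | `|z - y0| <= rho].
have inr z s : B z -> `|s| <= h -> `|y0 - (z + s *: xi)| < r.
  move=> Bz sh; rewrite distrC addrAC.
  apply: le_lt_trans (ler_normD _ _) _.
  have : `|s *: xi| <= h.
    rewrite normrZ -[leRHS]mulr1 ler_pM//.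
    by apply: le_trans (normr_le_enorm _) _; rewrite xi1.
  by move: Bz hrho; rewrite /B /= /rho; lra.
have Bpos z s : B z -> `|s| <= h -> 0 < edot (z + s *: xi) xi.
  by move=> Bz sh; have [] := ball_r _ (inr _ _ Bz sh).
have absh : `|h| <= h by rewrite gtr0_norm.
have absNh : `|- h| <= h by rewrite normrN gtr0_norm.
have Bpos0 z : B z -> 0 < edot z xi.
  by move=> Bz; have := Bpos z 0 Bz; rewrite normr0 scale0r addr0; apply; exact: ltW.
have approx z : B z -> `|quotient h z - Psi1 xi z| <= M * h.
  move=> Bz; apply: quotient_approx => // s sh.
  by split; [exact/y_neq0/Bpos|have [] := ball_r _ (inr _ _ Bz sh)].
(* The quadratic term is |z - y0|^2 up to an additive constant; on the boundary
   of B it beats the error M h of the difference quotient, so that the minimum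
   of Q over B is attained in the interior. *)
pose Q z := quotient h z + (eps * height xi z + eta * (edot z z - 2 * edot z y0)).
have By0 : B y0 by rewrite /B /= subrr normr0 ltW.
have [y1 By1 Qmin] : exists2 y1, B y1 & forall z, B z -> Q y1 <= Q z.
  have [|||y1 y1B y1min] := @EVT_min_rV R n.+1 Q B.
  - by exists y0.
  - apply: bounded_closed_compact.
      exists (`|y0| + rho); split; first exact: num_real.
      move=> K KM z /= Bz; rewrite -[z](subrK y0).
      apply: le_trans (ler_normD _ _) _; move: Bz KM; rewrite /B /=; lra.
    rewrite (_ : B = closed_ball y0 rho); first exact: closed_ball_closed.
    by rewrite closed_ballE//; apply/seteqP; split=> z; rewrite /B /= /closed_ball_ /= distrC.
  - apply: continuous_in_subspaceT => z /set_mem Bz.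
    suff : {for z, continuous Q} by [].
    apply: continuous_add; first by apply: quotient_cont; exact/y_neq0/Bpos.
    apply: continuous_add.
      by apply: continuous_mulC; apply: height_cont; exact/y_neq0/Bpos0.
    apply: continuous_mulC; apply: continuous_sub; first exact: continuous_edot_diag.
    by apply: continuous_mulC; exact: continuous_edot.
  - exists y1; first exact/set_mem.
    by move=> z Bz; apply: y1min; exact/mem_set.
have sqr z : edot z z - 2 * edot z y0 = edot (z - y0) (z - y0) - edot y0 y0.
  by rewrite !edotE (edotC y0 z); ring.
have y1rho : `|y1 - y0| < rho.
  rewrite lt_neqAle By1 andbT; apply/eqP => y1rho.
  have := Qmin _ By0; rewrite /Q !sqr subrr edot0r.
  (* [B] is a sup-norm ball, so the Euclidean distance from [y0] to its boundary is at least
     [rho]. *)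
  have : rho ^+ 2 <= edot (y1 - y0) (y1 - y0).
    rewrite -sqr_enorm -y1rho ler_pXn2r ?nnegrE ?normr_ge0 ?enorm_ge0//.
    exact: normr_le_enorm.
  rewrite -(ler_pM2l eta0).
  have := y0min _ (Bpos0 _ By1).
  have := approx _ By1; have := approx _ By0; rewrite !ler_norml.
  move=> /andP[? ?] /andP[? ?]; move: Mh; rewrite !mulrBr; lra.
have y1n s : `|s| <= h -> y1 + s *: xi != 0 by move=> sh; exact/y_neq0/Bpos.
pose Q1 w z := (2 * h)^-1 * (Psi1 w (z + h *: xi) - Psi1 w (z + (- h) *: xi)) +
  (eps * height1 xi w z + eta * (2 * edot w (z - y0))).
pose Q2 w := (2 * h)^-1 * (Psi2 w w (y1 + h *: xi) - Psi2 w w (y1 + (- h) *: xi)) +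
  (eps * height2 xi w y1 + eta * (2 * edot w w)).
have Bnear : \forall z \near y1, B z.
  apply/nbhs_normP; exists (rho - `|y1 - y0|); first by rewrite /= subr_gt0.
  move=> z; rewrite /ball_ /B /= => zy1.
  have := ler_distD y1 z y0; rewrite (distrC z y1); lra.
have Q2ge0 w : 0 <= Q2 w.
  apply: (@local_min_derive2_ge0 _ _ Q (Q1 w) y1 w).
  - near=> z; have Bz : B z by near: z.
    apply: is_derive_add; first by apply: dquotient; exact/y_neq0/Bpos.
    apply: is_derive_add; last exact: barrier_derive.
    by apply: is_derive_mulC; apply: is_derive_height; exact/y_neq0/Bpos0.
  - apply: is_derive_add; first by apply: d2quotient; exact: y1n.
    apply: is_derive_add; last exact: barrier_derive2.
    by apply: is_derive_mulC; apply: is_derive_height1; exact/y_neq0/Bpos0.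
  - by near=> z; apply: Qmin; near: z.
(* The second derivatives at the interior minimum have a nonnegative sum, whereas the quotient
   contributes at most 0 and the barrier with the quadratic term a negative amount. *)
have : 0 <= \sum_(i < n.+1) Q2 (e i) by apply: sumr_ge0.
rewrite big_split/= leNgt => /negP; apply.
rewrite -[ltRHS]addr0; apply: ler_ltD.
  by apply: trace_quotient_le0 => //; exact: Bpos.
have [] := ball_r y1 => //.
by have := inr y1 0 By1; rewrite normr0 scale0r addr0; apply; exact: ltW.
Unshelve. all: end_near. Qed.

End minimum_principle.

(** * Reflection in the hyperplane orthogonal to a direction *)

Section reflection.
Context (R : realType) (m : nat) (xi : 'rV[R]_m).
Hypothesis xi1 : edot xi xi = 1.
Implicit Types x y v : 'rV[R]_m.

Definition mirror y := y - (2 * edot xi y) *: xi.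

Lemma mirrorD x y : mirror (x + y) = mirror x + mirror y.
Proof. by rewrite /mirror edotDr mulrDr scalerDl opprD addrACA. Qed.

Lemma mirrorZ c y : mirror (c *: y) = c *: mirror y.
Proof. by rewrite /mirror edotZr mulrCA scalerBr scalerA. Qed.

Lemma mirror_normal : mirror xi = - xi.
Proof.
by rewrite /mirror xi1 mulr1 -[2]/(1 + 1) scalerDl scale1r opprD addNKr.
Qed.

Lemma mirror_orthogonal y : edot xi y = 0 -> mirror y = y.
Proof. by move=> y0; rewrite /mirror y0 mulr0 scale0r subr0. Qed.

Lemma mirror_line z s : edot xi z = 0 ->
  mirror (z + s *: xi) = z - s *: xi.
Proof.
by move=> z0; rewrite mirrorD mirrorZ mirror_normal mirror_orthogonal// scalerN.
Qed.

(** The reflection preserves Euclidean length. *)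
Lemma mirror_neq0 y : y != 0 -> mirror y != 0.
Proof.
move=> y0; rewrite -edot_eq0 (_ : edot _ _ = edot y y) ?edot_eq0//.
by rewrite /mirror !edotE xi1 (edotC y xi); ring.
Qed.

Lemma continuous_mirror : continuous mirror.
Proof.
move=> y; apply: (@cvgB _ _ _ (nbhs y)); first exact: cvg_id.
apply: cvgZr_tmp.
have := @continuous_mulC R _ 2 (fun x => edot x xi) y (@continuous_edot R m xi y).
rewrite /prop_for /continuous_at (edotC y).
by under eq_cvg do rewrite edotC.
Qed.

Lemma is_derive_mirror (f : 'rV[R]_m -> R) y v d :
  is_derive (mirror y) (mirror v) f d ->
  is_derive y v (fun y => f (mirror y)) d.
Proof.
move=> /is_derive_at fd; apply/is_derive_at.
rewrite (_ : (fun s => _) = (fun s : R => f (mirror y + s *: mirror v)))//.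
by apply/funext => s; rewrite mirrorD mirrorZ.
Qed.

End reflection.

Lemma is_derive_opp_dir (R : realType) (V : normedModType R) (f : V -> R)
    (x v : V) (d : R) : is_derive x v f d -> is_derive x (- v) f (- d).
Proof.
move=> /is_derive_at fd; apply/is_derive_at.
rewrite (_ : (fun s => _) = (fun s : R => f (x + s *: v)) \o -%R); last first.
  by apply/funext => s /=; rewrite scalerN scaleNr.
by rewrite -mulrN1; apply: is_derive1_comp; rewrite oppr0.
Qed.

(** Serves at points of the hyperplane, where nonnegativity is established on the side of [xi]
    only. *)
Lemma is_derive_right_min_ge0 (R : realType) (f : R -> R) (d : R) :
  is_derive (0 : R) (1 : R) f d -> (forall s, 0 < s -> f 0 <= f s) -> 0 <= d.
Proof.
move=> fd f0; rewrite leNgt; apply/negP => d0.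
have : \forall h \near 0^', h^-1 * (f (0 + h) - f 0) < 0.
  exact: (cvgr_lt _ (is_derive_cvg fd) _ d0).
move=> -[r /= r0 rf]; have r20 : 0 < r / 2 by rewrite divr_gt0.
have := rf (r / 2); rewrite /ball_ /= sub0r normrN gtr0_norm// add0r.
rewrite ltr_pdivrMr// ltr_pMr// ltr1n => /(_ isT (lt0r_neq0 r20)).
by rewrite pmulr_rlt0 ?invr_gt0// subr_lt0 ltNge f0.
Qed.

(** * Continuity of the degree 1 extension and its derivatives *)

Section sphere_C2_continuous.
Context (R : realType) (n : nat) (u : 'rV[R]_n.+1 -> R).
Hypothesis u_C2 : sphere_C2 u.
Implicit Types x v w : 'rV[R]_n.+1.
Local Notation U0 := (homog_ext 0 u).
Local Notation U := (homog_ext 1 u).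

Let cont_ext0 x : x != 0 -> {for x, continuous U0}.
Proof. by move=> /u_C2[dU _]; exact: differentiable_continuous. Qed.

Let cont_derive_ext0 x v : x != 0 -> {for x, continuous ('D_v U0)}.
Proof. by move=> /u_C2[_ [dU _]]; exact: differentiable_continuous. Qed.

Let cont_inv x : x != 0 -> {for x, continuous (fun y : 'rV[R]_n.+1 => (enorm y)^-1)}.
Proof.
by move=> x0; apply: continuousV; [rewrite gt_eqF ?enorm_gt0|exact: continuous_enorm].
Qed.

Lemma continuous_ext1 x : x != 0 -> {for x, continuous U}.
Proof.
move=> x0; rewrite (_ : U = fun y => enorm y * U0 y).
  by apply: continuous_mul; [exact: continuous_enorm|exact: cont_ext0].
by apply/funext => y; exact: homog_ext1E.
Qed.

Lemma continuous_derive_ext1 x v : x != 0 -> {for x, continuous ('D_v U)}.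
Proof.
move=> x0.
pose g y := edot y v * (enorm y)^-1 * U0 y + enorm y * 'D_v U0 y.
have gD y : y != 0 -> g y = 'D_v U y.
  by move=> y0; apply/esym; apply: derive_val; exact: is_derive_ext1.
have gc : {for x, continuous g}.
  apply: continuous_add; apply: continuous_mul.
  - by apply: continuous_mul; [exact: continuous_edot|exact: cont_inv].
  - exact: cont_ext0.
  - exact: continuous_enorm.
  - exact: cont_derive_ext0.
rewrite /prop_for /continuous_at -gD//; apply: (cvg_trans _ gc).
have gE : \forall y \near x, g y = 'D_v U y.
  by near=> y; apply: gD; near: y; exact: near_neq0.
exact: (near_eq_cvg gE).
Unshelve. all: end_near. Qed.

Lemma continuous_hess_ext1 x v w : x != 0 ->
  {for x, continuous (fun y => hess_ext1 u y v w)}.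
Proof.
move=> x0.
have cinv := cont_inv x0; have c0 := cont_ext0 x0.
have cD z : {for x, continuous ('D_z U0)} by exact: cont_derive_ext0.
have cdot z := @continuous_edot R n.+1 z x.
have cn := @continuous_enorm R n.+1 x.
rewrite (_ : (fun y => _) = (fun y =>
  (edot v w * (enorm y)^-1 -
    edot y v * (edot y w * ((enorm y)^-1 * ((enorm y)^-1 * (enorm y)^-1)))) * U0 y
  + edot y v * (enorm y)^-1 * 'D_w U0 y + edot y w * (enorm y)^-1 * 'D_v U0 y
  + enorm y * 'D_w ('D_v U0) y)); last first.
  by apply/funext => y; rewrite /hess_ext1 !exprS expr0 mulr1 !invfM !mulrA.
apply: continuous_add; [apply: continuous_add; [apply: continuous_add|]|].
- apply: continuous_mul c0; apply: continuous_sub; first exact: continuous_mulC.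
  exact (continuous_mul (cdot v) (continuous_mul (cdot w)
    (continuous_mul cinv (continuous_mul cinv cinv)))).
- exact (continuous_mul (continuous_mul (cdot v) cinv) (cD w)).
- exact (continuous_mul (continuous_mul (cdot w) cinv) (cD v)).
- by apply: (continuous_mul cn); have [_ [_]] := u_C2 x0; exact.
Qed.

End sphere_C2_continuous.

(** Here the condition on [f] is used for the single direction [xi]; it provides the monotonicity
    assumption of [minimum_principle] for [Psi]. *)
Lemma hess_ext1_unit_ge0 (R : realType) (n : nat) (f u : 'rV[R]_n.+1 -> R)
    (x xi : 'rV[R]_n.+1) :
  (0 < n)%N -> [lipschitz f x | x in @unit_sphere R n] -> sphere_C2 u ->
  (forall x, unit_sphere x -> laplace_beltrami u x + n%:R * u x = f x) ->
  (forall (t : R) (x : 'rV[R]_n.+1), 0 < t -> edot xi x = 0 ->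
     derivable (homog_ext (-1) f) (x + t *: xi) xi ->
     derivable (homog_ext (-1) f) (x - t *: xi) xi ->
     'D_xi (homog_ext (-1) f) (x + t *: xi)
       - 'D_xi (homog_ext (-1) f) (x - t *: xi) <= 0) ->
  unit_sphere xi -> x != 0 -> edot xi x = 0 -> 0 <= hess_ext1 u x xi xi.
Proof.
move=> n_gt0 f_lip u_C2 u_sol f_cond xi1 x0 xix.
have xixi := unit_sphere_edot xi1.
pose U := homog_ext 1 u; pose F := homog_ext (-1) f; pose H := hess_ext1 u.
pose s := mirror xi.
have s0 y : y != 0 -> s y != 0 by exact: mirror_neq0.
have dU y v : y != 0 -> is_derive y v U ('D_v U y).
  by move=> y0; have [? _] := is_derive_ext1 u_C2 v y0; exact: DeriveDef.
have d2U y v w : y != 0 -> is_derive y w ('D_v U) (H y v w).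
  by move=> y0; exact: is_derive2_ext1.
pose Psi y := U y + U (s y).
pose Psi1 v y := 'D_v U y + 'D_(s v) U (s y).
pose Psi2 v w y := H y v w + H (s y) (s v) (s w).
have dPsi y v : y != 0 -> is_derive y v Psi (Psi1 v y).
  move=> y0; apply: is_derive_add; first exact: dU.
  by apply: is_derive_mirror; apply: dU; exact: s0.
have dPsi1 y v w : y != 0 -> is_derive y w (Psi1 v) (Psi2 v w y).
  move=> y0.
  exact (is_derive_add (d2U y v w y0) (is_derive_mirror
    (f := 'D_(s v) U) (d2U (s y) (s v) (s w) (s0 _ y0)))).
have cs (g : 'rV[R]_n.+1 -> R) : (forall y, y != 0 -> {for y, continuous g}) ->
    forall y, y != 0 -> {for y, continuous (fun y => g (s y))}.
  move=> gc y y0; apply: (@continuous_comp _ _ _ s g).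
    exact: continuous_mirror.
  by apply: gc; exact: s0.
have Psi_cont y : y != 0 -> {for y, continuous Psi}.
  move=> y0; apply: continuous_add; first exact: continuous_ext1.
  by apply: cs => // z z0; exact: continuous_ext1.
have Psi1_cont y : y != 0 -> {for y, continuous (Psi1 xi)}.
  move=> y0; apply: continuous_add; first exact: continuous_derive_ext1.
  by apply: (cs ('D_(s xi) U)) => // z z0; exact: continuous_derive_ext1.
have Psi2_cont y : y != 0 -> {for y, continuous (Psi2 xi xi)}.
  move=> y0; apply: continuous_add; first exact: continuous_hess_ext1.
  by apply: (cs (fun y => H y (s xi) (s xi))) => // z z0; exact: continuous_hess_ext1.
have trace y : y != 0 ->
    \sum_(i < n.+1) Psi2 (delta_mx 0 i) (delta_mx 0 i) y = F y + F (s y).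
  move=> y0; have sy0 := s0 _ y0.
  have T1 : _ = F y := trace_hess_ext1 u_C2 y0 u_sol.
  (* For [c = 2] the shifted basis is the reflected one and the correction [4 - 4] vanishes: the
     trace is invariant under reflection. *)
  have T2 := bilinear_trace_shift xi 2
    (fun a v w z => hess_ext1_linearl u_C2 a v w z sy0)
    (fun a v w z => hess_ext1_linearr u_C2 a v w z sy0).
  have c0 : (2 ^+ 2 * edot xi xi - 2 * 2) * H (s y) xi xi = 0.
    by rewrite xixi (_ : 2 ^+ 2 * 1 - 2 * 2 = 0) ?mul0r//; ring.
  have {c0}T2 := etrans T2 (congr1 (fun t => _ + t) c0).
  rewrite addr0 in T2.
  have {}T2 : _ = F (s y) := etrans T2 (trace_hess_ext1 u_C2 sy0 u_sol).
  by rewrite -T1 -T2 -big_split.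
have Psi1_homog c y : 0 < c -> y != 0 -> Psi1 xi (c *: y) = Psi1 xi y.
  move=> c0 y0.
  have D v z : z != 0 -> 'D_v U (c *: z) = 'D_v U z.
    move=> z0; apply: derive_val; rewrite -['D_v U z]mul1r -(mulfV (lt0r_neq0 c0)).
    apply: is_derive_homog (dU _ v z0) => //.
    by near=> t; rewrite /U homog_extZ// expr1z.
  by rewrite /Psi1 /s mirrorZ !D// s0.
(* At a point fixed by the reflection the two terms are derivatives of [U] along [xi] and [- xi],
   which cancel. *)
have Psi1_bound y : y != 0 -> edot y xi = 0 -> Psi1 xi y = 0.
  move=> y0; rewrite edotC => yxi.
  rewrite /Psi1 /s mirror_orthogonal// mirror_normal//.
  by rewrite (@derive_val _ _ _ _ _ _ _ (is_derive_opp_dir (dU _ xi y0))) subrr.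
have mono z (a b : R) : edot xi z = 0 -> 0 < a -> a <= b ->
    F (z + b *: xi) + F (s (z + b *: xi)) <= F (z + a *: xi) + F (s (z + a *: xi)).
  move=> xiz a0 ab; rewrite /s !mirror_line//.
  apply: homog_ext_reflect_nonincreasing => // t t0; exact: f_cond.
have Psi1_ge0 := minimum_principle n_gt0 xi1 dPsi dPsi1 Psi_cont Psi1_cont
  Psi2_cont trace Psi1_homog Psi1_bound mono.
(* [Psi1 xi] vanishes at [x] and is nonnegative at [x + t *: xi] for [t > 0], so its derivative
   along [xi] at [x] is nonnegative. *)
have : 0 <= Psi2 xi xi x.
  have /is_derive_at := dPsi1 _ xi xi x0.
  move=> /is_derive_right_min_ge0; apply => t t0.
  rewrite scale0r addr0 Psi1_bound ?Psi1_ge0//.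
    by rewrite edotDl edotZl edotC xix add0r xixi mulr1.
  by rewrite edotC.
(* Since [x] is fixed and [xi] reversed by the reflection, bilinearity makes the two Hessian terms
   equal. *)
rewrite /Psi2 /s mirror_orthogonal// mirror_normal//.
have -> : H x (- xi) (- xi) = H x xi xi.
  have Hl a v z := linear_formZ (l := fun v => H x v z) a v
    (fun a v w => hess_ext1_linearl u_C2 a v w z x0).
  have Hr a v z := linear_formZ (l := H x z) a v
    (fun a v w => hess_ext1_linearr u_C2 a v w z x0).
  by rewrite -scaleN1r Hl Hr !mulN1r opprK.
by rewrite -[hess_ext1 u x xi xi]/(H x xi xi); lra.
Unshelve. all: end_near. Qed.

Theorem theorem3p4 (R : realType) (n : nat) (f u : 'rV[R]_n.+1 -> R)
  (n_ge2 : (2 <= n)%N)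
  (f_lip : [lipschitz f x | x in @unit_sphere R n])
  (f_pos : forall x : 'rV[R]_n.+1, unit_sphere x -> 0 < f x)
  (u_C2 : sphere_C2 u)
  (u_sol : forall x : 'rV[R]_n.+1, unit_sphere x ->
     laplace_beltrami u x + n%:R * u x = f x)
  (f_cond : forall (t : R) (xi x : 'rV[R]_n.+1),
     0 < t -> unit_sphere xi -> edot xi x = 0 ->
     derivable (homog_ext (-1) f) (x + t *: xi) xi ->
     derivable (homog_ext (-1) f) (x - t *: xi) xi ->
     'D_xi (homog_ext (-1) f) (x + t *: xi)
       - 'D_xi (homog_ext (-1) f) (x - t *: xi) <= 0) :
  sphere_convex u.

Proof.
move=> x xi x1 xxi.
rewrite -hess_ext1_tangent//.
have x0 := unit_sphere_neq0 x1.
have Hl a v z := linear_formZ (l := fun v => hess_ext1 u x v z) a v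
  (fun a v w => hess_ext1_linearl u_C2 a v w z x0).
have Hr a v z := linear_formZ (l := hess_ext1 u x z) a v
  (fun a v w => hess_ext1_linearr u_C2 a v w z x0).
have [->|xi0] := eqVneq xi 0.
  by rewrite -(scale0r (0 : 'rV[R]_n.+1)) Hl mul0r.
(* Bilinearity extracts the squared norm of [xi] and leaves a unit direction; the zero vector is set
   apart since it cannot be normalized. *)
rewrite -(enorm_radialK xi0) Hl Hr mulrA mulr_ge0 ?mulr_ge0 ?enorm_ge0//.
have r1 : unit_sphere (radial_proj xi) by exact: enorm_radial.
apply: (hess_ext1_unit_ge0 (f := f)) => //.
- exact: ltn_trans n_ge2.
- by move=> t y t0; exact: f_cond.
- by rewrite /radial_proj edotZl edotC xxi mulr0.
Qed.
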